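(* Let $\kappa>0$. For $h,\varepsilon>0$ define $E_{h,\varepsilon}:H^2(I;\mathbb{R}^3)\to\mathbb{R}\cup\{+\infty\}$ by $$E_{h,\varepsilon}[u_h]=\frac{\kappa}{2}\int_I|u_h''|^2\,\mathrm{d}x+\frac{1}{2\varepsilon}\int_I\mathcal{I}_{1,h}V_D(u_h)\,\mathrm{d}x$$ if $u_h\in\mathcal{A}_h$, and $E_{h,\varepsilon}[u_h]=+\infty$ if $u_h\in H^2(I;\mathbb{R}^3)\setminus\mathcal{A}_h$. Analogously, let $$E_{\rm bend}[u]=\frac{\kappa}{2}\int_I|u''|^2\,\mathrm{d}x$$ for $u\in\mathcal{A}\cap D$, and $E_{\rm bend}[u]=+\infty$ if $u\in H^2(I;\mathbb{R}^3)\setminus(\mathcal{A}\cap D)$. (i) For every sequence $(u_h)_{h>0}\subset H^2(I;\mathbb{R}^3)$ (indexed by a sequence $(h,\varepsilon)\to 0$) with weak limit $u\in H^2(I;\mathbb{R}^3)$ one has $$E_{\rm bend}[u]\le\liminf_{(h,\varepsilon)\to0}E_{h,\varepsilon}[u_h].$$ (ii) For every $u\in\mathcal{A}\cap D$ with $u\in H^3(I;\mathbb{R}^3)$ there exists a sequence $(u_h)_{h>0}\subset H^2(I;\mathbb{R}^3)$ such that $$\lim_{(h,\varepsilon)\to0}E_{h,\varepsilon}[u_h]=E_{\rm bend}[u].$$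
   Context: $I\subset\mathbb{R}$ is a bounded interval. Confinement: $D=\bigcap_{r=1}^R D_r\subset\mathbb{R}^3$ is a composite quadratic confinement, where $D_r=\{y\in\mathbb{R}^3:|y|_{D_r}^2=y\cdot G_{D_r}y\le1\}$ with symmetric positive semi-definite matrices $G_{D_r}\in\mathbb{R}^{3\times3}$ and $|y|_{D_r}=(y\cdot G_{D_r}y)^{1/2}$. The potential is $V_D(y)=\sum_{r=1}^R V_{D_r}(y)$ with $V_{D_r}(y)=\frac12(|y|_{D_r}-1)_+^2$, where $s_+=\max\{s,0\}$. Boundary conditions: $L_{\rm bc}:H^2(I;\mathbb{R}^3)\to\mathbb{R}^\ell$ is a bounded linear operator realizing boundary conditions, i.e. $L_{\rm bc}[v]$ depends only on the values of $v$ and $v'$ at the endpoints of $I$ (e.g. clamped or periodic conditions); $\ell_{\rm bc}\in\mathbb{R}^\ell$ is fixed. Admissible set: $\mathcal{A}=\{v\in H^2(I;\mathbb{R}^3):|v'|=1\text{ a.e. in }I,\ L_{\rm bc}[v]=\ell_{\rm bc}\}$, and $u\in\mathcal{A}\cap D$ means $u\in\mathcal{A}$ and $u(x)\in D$ for all $x\in I$. Discretization: for each $h>0$, $\mathcal{P}_h$ is a partition of $I$ with nodes $x_0<x_1<\dots<x_N$ ($x_0,x_N$ the endpoints of $I$) and maximal subinterval length $h$. $V_h\subset H^2(I)$ is the space of globally continuously differentiable functions that are cubic polynomials on each subinterval. $\mathcal{I}_{1,h}$ is the nodal interpolation operator into globally continuous functions that are affine on each subinterval. The discrete admissible set is $\mathcal{A}_h=\{u_h\in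 V_h^3:|u_h'(x_i)|^2=1,\ i=0,1,\dots,N,\ L_{\rm bc}[u_h]=\ell_{\rm bc}\}$. *)

(* Defs.v *)
From HB Require Import structures.
From mathcomp Require Import all_boot all_order all_algebra.
From mathcomp Require Import all_classical all_reals all_analysis.
From mathcomp Require Import measurable_realfun lra.

Set Implicit Arguments.
Unset Strict Implicit.
Unset Printing Implicit Defensive.

Import Order.TTheory GRing.Theory Num.Theory.
Import numFieldNormedType.Exports.

Local Open Scope classical_set_scope.
Local Open Scope ring_scope.

Section EuclideanSpace.
Context {R : realType} {n : nat}.
Implicit Types y z : 'cV[R]_n.

Definition dotv y z : R := (y^T *m z) 0 0.

(* The library norm on matrices is the sup norm. *)
Definition enorm y : R := Num.sqrt (dotv y y).

End EuclideanSpace.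

Section Sobolev.
Context {R : realType}.
Variables a b : R.
Local Notation mu := (@lebesgue_measure R).

Definition L2 (f : R -> R) : Prop := f \_ `[a, b] \in Lfun mu 2%:E.

(* C_c^oo functions of the open interval ]a, b[, extended by zero *)
Definition test_function (phi : R -> R) : Prop :=
  (forall k x, derivable (derive1n k phi) x 1) /\
  exists c d, [/\ a < c, d < b & forall x, x \notin `[c, d] -> phi x = 0].

Definition weak_derivative (f g : R -> R) : Prop :=
  forall phi, test_function phi ->
    \int[mu]_(x in `[a, b]) (f x * derive1 phi x) =
    - \int[mu]_(x in `[a, b]) (g x * phi x).

(* A jet (v, v', v'') of an element of H^2(a, b): the L^2 conditions and the
   two weak derivatives are the definition of H^2; the two continuity
   conditions select the representatives of v and v' that are used for point
   evaluation (they exist by the Sobolev embedding H^2(a, b) -> C^1([a, b])).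
   Values outside [a, b], and the choice of v'' on null sets, are irrelevant. *)
Definition H2_jet (w : (R -> R^o) * (R -> R^o) * (R -> R^o)) : Prop :=
  let: (v, v', v'') := w in
  [/\ L2 v, L2 v' & L2 v''] /\
  [/\ weak_derivative v v', weak_derivative v' v'',
      {within `[a, b], continuous v} & {within `[a, b], continuous v'}].

Definition H2_pred : {pred (R -> R^o) * (R -> R^o) * (R -> R^o)} :=
  fun w => `[< H2_jet w >].

Record H2 := mkH2 { H2val : (R -> R^o) * (R -> R^o) * (R -> R^o) ;
                    H2valP : H2_pred H2val }.

HB.instance Definition _ := [isSub for H2val].
HB.instance Definition _ := [Choice of H2 by <:].

Lemma L2_lin (c : R) (f g : R -> R^o) : L2 f -> L2 g -> L2 (c *: f + g).
Proof.
rewrite /L2 => Lf Lg.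
have -> : (c *: f + g) \_ `[a, b] =
    c *: ((f : R -> R) \_ `[a, b] : R -> R^o) + (g : R -> R) \_ `[a, b].
  apply/funext => x; rewrite /patch [RHS]/(c *: _ + _).
  by case: ifP => // _; rewrite /= -[LHS]/0 -[RHS]/(c * 0 + 0) mulr0 addr0.
have [_ +] := @Lfun_submod_closed _ _ _ mu 2%:E (lee1n 2).
by apply.
Qed.

Lemma L2_measurable (f : R -> R) : L2 f -> measurable_fun `[a, b] f.
Proof.
move=> /andP[/[!inE]/= mf _].
by apply/(measurable_restrictT f) => //; exact: measurable_itv.
Qed.

Lemma L2_sqr_integrable (f : R -> R) : L2 f ->
  mu.-integrable `[a, b] (EFin \o (fun x => f x ^+ 2)).
Proof.
move=> /Lfun2_integrable_sqr.
rewrite [X in _ -> X]integrable_mkcond; last exact: measurable_itv.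
apply: eq_integrable => // x _ /=; rewrite /patch.
by case: ifP => //= _; rewrite expr0n.
Qed.

Lemma L2_continuous_integrable (f g : R -> R) : L2 f -> continuous g ->
  mu.-integrable `[a, b] (EFin \o (fun x => f x * g x)).
Proof.
move=> Lf cg.
have mI : measurable (`[a, b] : set (measurableTypeR R)) by exact: measurable_itv.
have ig : mu.-integrable `[a, b] (EFin \o (fun x => g x ^+ 2)).
  apply: continuous_compact_integrable; first exact: segment_compact.
  apply: continuous_subspaceT => x.
  by apply: (@continuousM R R g g); exact: cg.
apply: (le_integrable mI _ _ (integrableD mI (L2_sqr_integrable Lf) ig)).
  apply/measurable_EFinP; apply: measurable_funM; first exact: L2_measurable.
  apply: measurable_funTS; exact: continuous_measurable_fun.
move=> x _; rewrite /= lee_fin [leRHS]ger0_norm ?addr_ge0 ?sqr_ge0//.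
rewrite normrM -[f x ^+ 2]real_normK ?num_real//.
rewrite -[g x ^+ 2]real_normK ?num_real//.
have := mulr_ge0 (normr_ge0 (f x)) (normr_ge0 (g x)).
have := sqr_ge0 (`|f x| - `|g x|); rewrite sqrrB.
move: (`|f x| * `|g x|) (`|f x| ^+ 2) (`|g x| ^+ 2) => p q r; lra.
Qed.

Lemma Rintegral_lin (c : R) (f g p : R -> R) : L2 f -> L2 g -> continuous p ->
  \int[mu]_(x in `[a, b]) ((c * f x + g x) * p x) =
  c * \int[mu]_(x in `[a, b]) (f x * p x) + \int[mu]_(x in `[a, b]) (g x * p x).
Proof.
move=> Lf Lg cp.
have mI : measurable (`[a, b] : set (measurableTypeR R)) by exact: measurable_itv.
rewrite -RintegralZl//; last exact: L2_continuous_integrable.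
rewrite -RintegralD//; last exact: L2_continuous_integrable.
- by congr fine; apply: eq_integral => x _; rewrite mulrDl mulrA.
- exact: eq_integrable (integrableZl mI c (L2_continuous_integrable Lf cp)).
Qed.

Lemma test_function_continuous phi : test_function phi ->
  continuous phi /\ continuous (derive1 phi).
Proof.
move=> [dphi _]; split=> x; apply: differentiable_continuous;
  apply/derivable1_diffP.
- exact: (dphi 0%N).
- exact: (dphi 1%N).
Qed.

Lemma weak_derivative_lin (c : R) (f f' g g' : R -> R^o) :
  L2 f -> L2 f' -> L2 g -> L2 g' ->
  weak_derivative f f' -> weak_derivative g g' ->
  weak_derivative (c *: f + g) (c *: f' + g').
Proof.
move=> Lf Lf' Lg Lg' wf wg phi tphi.
have [c0 c1] := test_function_continuous tphi.
rewrite (Rintegral_lin c Lf Lg c1) (Rintegral_lin c Lf' Lg' c0) wf// wg//.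
by rewrite mulrN opprD.
Qed.

Lemma L2_0 : L2 0.
Proof.
rewrite /L2.
have -> : (0 : R -> R) \_ `[a, b] = 0.
  by apply/funext => x; rewrite /patch; case: ifP.
by have [] := @Lfun_submod_closed _ _ _ mu 2%:E (lee1n 2).
Qed.

Lemma weak_derivative_0 : weak_derivative 0 0.
Proof.
move=> phi _; rewrite /Rintegral.
under eq_integral do rewrite mul0r.
under [in RHS]eq_integral do rewrite mul0r.
by rewrite integral0 oppr0.
Qed.

Lemma within_continuous_lin (c : R) (f g : R -> R^o) :
  {within `[a, b], continuous f} -> {within `[a, b], continuous g} ->
  {within `[a, b], continuous (c *: f + g)}.
Proof.
move=> /subspace_continuousP cf /subspace_continuousP cg.
apply/subspace_continuousP => x Ax; apply: cvgD; last exact: cg.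
by apply: cvgZl_tmp; exact: cf.
Qed.

Lemma H2_submod_closed : submod_closed H2_pred.
Proof.
split.
  apply/asboolP; split; split; try exact: L2_0; try exact: weak_derivative_0.
  - exact: continuous_subspaceT (fun=> cvg_cst _).
  - exact: continuous_subspaceT (fun=> cvg_cst _).
move=> c [[u u'] u''] [[v v'] v''] /asboolP[[Lu Lu' Lu''] [wu wu' cu cu']].
move=> /asboolP[[Lv Lv' Lv''] [wv wv' cv cv']].
have -> : c *: (u, u', u'') + (v, v', v'') =
    (c *: u + v, c *: u' + v', c *: u'' + v'') by [].
apply/asboolP; split.
  by split; [exact: (L2_lin c Lu Lv) | exact: (L2_lin c Lu' Lv')
            | exact: (L2_lin c Lu'' Lv'')].
split.
- exact: (weak_derivative_lin c Lu Lu' Lv Lv').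
- exact: (weak_derivative_lin c Lu' Lu'' Lv' Lv'').
- exact: within_continuous_lin.
- exact: within_continuous_lin.
Qed.

HB.instance Definition _ :=
  GRing.isSubmodClosed.Build R _ H2_pred H2_submod_closed.
HB.instance Definition _ := [SubChoice_isSubLmodule of H2 by <:].


Definition H2_fun (v : H2) : R -> R := (H2val v).1.1.
Definition H2_d1 (v : H2) : R -> R := (H2val v).1.2.
Definition H2_d2 (v : H2) : R -> R := (H2val v).2.

Definition in_H3 (v : H2) : Prop :=
  exists g, L2 g /\ weak_derivative (H2_d2 v) g.

(* H^2(a, b; R^3) *)
Definition H2v := {ffun 'I_3 -> H2}.

Definition vfun (u : H2v) (x : R) : 'cV[R]_3 := \col_i H2_fun (u i) x.
Definition vd1 (u : H2v) (x : R) : 'cV[R]_3 := \col_i H2_d1 (u i) x.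
Definition vd2 (u : H2v) (x : R) : 'cV[R]_3 := \col_i H2_d2 (u i) x.

Definition in_H3v (u : H2v) : Prop := forall i, in_H3 (u i).

Definition L2sq (f : R -> 'cV[R]_3) : R :=
  \int[mu]_(x in `[a, b]) (enorm (f x) ^+ 2).

Definition H2norm (u : H2v) : R :=
  Num.sqrt (L2sq (vfun u) + L2sq (vd1 u) + L2sq (vd2 u)).

Definition bounded_op (l : nat) (L : H2v -> 'cV[R]_l) : Prop :=
  exists C : R, forall v, enorm (L v) <= C * H2norm v.

Definition weak_cvg (u_ : nat -> H2v) (u : H2v) : Prop :=
  forall F : {scalar H2v}, (exists C : R, forall v, `|F v| <= C * H2norm v) ->
    F (u_ n) @[n --> \oo] --> F u.

Definition endpoint_op (l : nat) (L : H2v -> 'cV[R]_l) : Prop :=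
  forall u v : H2v,
    vfun u a = vfun v a -> vd1 u a = vd1 v a ->
    vfun u b = vfun v b -> vd1 u b = vd1 v b -> L u = L v.

End Sobolev.

Arguments H2v {R} a b.

Section Confinement.
Context {R : realType} {m : nat}.

Definition psd (G : 'M[R]_3) : Prop := forall y, 0 <= dotv y (G *m y).

Definition quadric (G : 'M[R]_3) : set 'cV[R]_3 :=
  [set y | dotv y (G *m y) <= 1].

Definition qnorm (G : 'M[R]_3) (y : 'cV[R]_3) : R := Num.sqrt (dotv y (G *m y)).

Definition confinement (G : 'I_m -> 'M[R]_3) : set 'cV[R]_3 :=
  \bigcap_r quadric (G r).

Definition VD (G : 'I_m -> 'M[R]_3) (y : 'cV[R]_3) : R :=
  \sum_r 2^-1 * Num.max (qnorm (G r) y - 1) 0 ^+ 2.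

End Confinement.

(* A partition of [a, b] is, as in itv_partition, the list s = [:: x_1; ...; x_N]
   with x_0 = a left out, so that the nodes are a :: s. *)
Section Discretization.
Context {R : realType}.
Local Notation mu := (@lebesgue_measure R).

Definition mesh (a : R) (s : seq R) : R :=
  \big[Num.max/0]_(d <- pairmap (fun x y => y - x) a s) d.

Fixpoint interp1 (f : R -> R) (x0 : R) (s : seq R) (t : R) : R :=
  if s is x1 :: s' then
    if t <= x1 then f x0 + (f x1 - f x0) / (x1 - x0) * (t - x0)
    else interp1 f x1 s' t
  else f x0.

Variables a b : R.

(* C^1 on [a, b]: H2_d1 v is continuous on [a, b] for every v : H2 a b. *)
Definition Vh (s : seq R) (v : H2 a b) : Prop :=
  (forall x : R, x \in `]a, b[ -> is_derive x 1 (H2_fun v : R -> R^o) (H2_d1 v x)) /\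
  (forall i, (i < size s)%N -> exists2 p : {poly R}, (size p <= 4)%N &
     forall x, x \in `[(a :: s)`_i, s`_i] -> H2_fun v x = p.[x]).

Variables (m l : nat) (G : 'I_m -> 'M[R]_3).
Variables (Lbc : H2v a b -> 'cV[R]_l) (lbc : 'cV[R]_l) (kappa : R).

Definition admissible : set (H2v a b) :=
  [set v : H2v a b | {ae mu, forall x, x \in `[a, b] -> enorm (vd1 v x) = 1} /\
           Lbc v = lbc].

Definition admissibleD : set (H2v a b) :=
  [set v : H2v a b | admissible v /\ forall x, x \in `[a, b] -> confinement G (vfun v x)].

Definition admissible_h (s : seq R) : set (H2v a b) :=
  [set v : H2v a b | [/\ forall i, Vh s (v i),
              forall x, x \in a :: s -> enorm (vd1 v x) ^+ 2 = 1 &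
              Lbc v = lbc]].

Definition Ebend (u : H2v a b) : \bar R :=
  if `[< admissibleD u >] then
    (kappa / 2 * \int[mu]_(x in `[a, b]) (enorm (vd2 u x) ^+ 2))%:E
  else +oo%E.

Definition Eh (s : seq R) (eps : R) (u : H2v a b) : \bar R :=
  if `[< admissible_h s u >] then
    (kappa / 2 * \int[mu]_(x in `[a, b]) (enorm (vd2 u x) ^+ 2) +
     (2 * eps)^-1 *
       \int[mu]_(x in `[a, b]) (interp1 (fun t => VD G (vfun u t)) a s x))%:E
  else +oo%E.

End Discretization.

(* Main.v *)
Require Import Defs.
From HB Require Import structures.
From mathcomp Require Import all_boot all_order all_algebra.
From mathcomp Require Import all_classical all_reals all_analysis.
From mathcomp Require Import measurable_realfun ring lra.

(** A discretely admissible function has a derivative of unit length at the nodes, and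
    the penalty sees its values at the nodes, so the proof has to pass from nodes to
    points.  Everything rests on one fact about weak derivatives, the fundamental theorem of
    calculus [weak_FTC]: if g is the weak derivative of f, then the increment of f
    between two Lebesgue points is the integral of g.  It is obtained by testing with
    smooth approximations of indicator functions.  With Cauchy-Schwarz it yields
    Hoelder continuity with exponent 1/2 ([H1_oscillation]) and the continuity of
    point evaluations on H^2 ([H1_pointwise]).

    For the liminf inequality one may assume that the energies are bounded by K along
    a subsequence.  Then the second derivatives are bounded in L^2, so the first
    derivatives are uniformly Hoelder continuous.  Weak convergence gives pointwise
    convergence of the functions and of their first derivatives.  Hence the unit
    length at the nodes is inherited by the limit everywhere ([limit_unit]), bounded
    linear boundary conditions pass to the limit ([limit_boundary]), and the penalty,
    which is at most 2 eps K, forces the limit into D ([limit_confined]): a violated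
    constraint would keep the potential bounded below on an interval of fixed length.
    The bending energy is weakly lower semicontinuous ([limit_bend]).

    For the recovery sequence take the cubic Hermite interpolant of u.  It agrees with
    u and u' at the nodes, therefore it is discretely admissible and its penalty is
    zero ([hermite_interpolant]).  Since u''' is square integrable, u'' has a Hoelder
    continuous representative ([H3_regular]), and comparing the Hermite cubic of a cell
    with the second order Taylor polynomial of u shows that the second derivatives
    differ by O(h^(1/2)) uniformly ([hermite_error]).  So the bending energies
    converge.  The interpolant lies in H^2 because it is a linear combination of
    truncated powers ([hermite_spline]). *)

Set Implicit Arguments.
Unset Strict Implicit.
Unset Printing Implicit Defensive.

Import Order.TTheory GRing.Theory Num.Theory.
Import numFieldNormedType.Exports.

Local Open Scope classical_set_scope.
Local Open Scope ring_scope.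

(** * Smooth step functions *)

Section SmoothStep.
Context {R : realType}.
Implicit Types (f g : R -> R) (p : {poly R}) (t : R).

(** A quadratic bound at t0 settles differentiability there without any formula
    for f near t0; it is used where functions given by cases are glued. *)
Lemma is_derive_quadratic f (t0 C : R) :
  (forall t, `|f t| <= C * (t - t0) ^+ 2) -> is_derive t0 1 f 0.
Proof.
move=> fC; have f0 : f t0 = 0.
  by apply/eqP; rewrite -normr_le0 (le_trans (fC _))// subrr expr0n mulr0.
have C0 : 0 <= C.
  by have := le_trans (normr_ge0 _) (fC (t0 + 1)); rewrite addrC addKr expr1n mulr1.
suff h : h^-1 *: ((f \o shift t0) (h *: (1:R)) - f t0) @[h --> 0^'] --> (0 : R).
  by apply: DeriveDef; [apply/cvg_ex; exists 0|exact/cvg_lim].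
apply/cvgrPdist_le => e e0; near=> h.
rewrite sub0r normrN f0 subr0 /= /shift/=.
have h0 : h != 0 by near: h; exact: nbhs_dnbhs_neq.
rewrite -[_ *: _]/(_ * _) normrM normfV ler_pdivrMl ?normr_gt0//.
apply: (le_trans (fC _)); rewrite addrK -[h *: 1]/(h * 1) mulr1.
rewrite -real_normK ?num_real// expr2 mulrCA ler_wpM2l//.
have : `|h| <= e / (C + 1).
  by near: h; apply: dnbhs0_le; rewrite divr_gt0// ltr_wpDl.
rewrite ler_pdivlMr ?ltr_wpDl// mulrDr mulr1 mulrC => /(le_trans _); apply.
by rewrite lerDl.
Unshelve. all: by end_near. Qed.

(** p(t) w^(-n) exp(-1/w) with w = t (1 - t), extended by 0.  Keeping the
    polynomial p and the exponent n as parameters makes the family stable under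
    differentiation. *)
Definition bump p n t : R :=
  if 0 < t < 1 then p.[t] * (t * (1 - t))^-1 ^+ n * expR (- (t * (1 - t))^-1)
  else 0.

(** The factor exp(-1/w) is at most (n+2)! w^(n+2), so it absorbs w^(-n) and
    leaves w^2.  This bound makes all the bumps differentiable, with derivative 0,
    at and outside the end points. *)
Lemma bump_quadratic p n : exists2 C, 0 <= C &
  forall t, 0 < t < 1 -> `|bump p n t| <= C * (t * (1 - t)) ^+ 2.
Proof.
exists ((\sum_(i < size p) `|p`_i|) * (n.+2)`!%:R).
  by rewrite mulr_ge0// sumr_ge0.
move=> t t01; rewrite /bump t01.
have /andP[t0 t1] := t01; set w := t * (1 - t).
have w0 : 0 < w by rewrite mulr_gt0// subr_gt0.
have wV0 : 0 < w^-1 by rewrite invr_gt0.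
rewrite !normrM normrX (gtr0_norm wV0) (gtr0_norm (expR_gt0 _)) -mulrA -[leRHS]mulrA.
apply: ler_pM => //.
- by rewrite mulr_ge0// ?expR_ge0// exprn_ge0// ltW.
- rewrite horner_coef (le_trans (ler_norm_sum _ _ _))// ler_sum// => i _.
  by rewrite normrM ler_piMr// normrX exprn_ile1// gtr0_norm// ltW.
- have := expR_ge1Dxn n.+1 (ltW wV0); set k := (n.+2)`!%:R => h.
  have k0 : 0 < k by rewrite ltr0n fact_gt0.
  have : w^-1 ^+ n.+2 / k <= expR w^-1 by rewrite (le_trans _ h)// lerDr.
  rewrite ler_pdivrMr// expRN => {}h.
  rewrite ler_pdivrMr ?expR_gt0//.
  rewrite -(@ler_pM2l _ (w^-1 ^+ 2)) ?exprn_gt0// -exprD (le_trans h)//.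
  by rewrite [leRHS]mulrA [_ * (k * _)]mulrCA -exprMn mulVf ?gt_eqF// expr1n mulr1 mulrC.
Qed.

(** Numerator of the derivative over w^(n+2), using w' = 1 - 2 t. *)
Definition bump_deriv p n : {poly R} :=
  p^`() * ('X - 'X^2) ^+ 2 - n%:R *: (p * (1 - 'X *+ 2) * ('X - 'X^2))
  + p * (1 - 'X *+ 2).

Lemma is_derive_bump p n t :
  is_derive t 1 (bump p n) (bump (bump_deriv p n) n.+2 t).
Proof.
have [/[dup] t01 /andP[t0 t1]|t01] := boolP (0 < t < 1); last first.
  rewrite {2}/bump (negbTE t01).
  have [C C0 pC] := bump_quadratic p n.
  apply: (@is_derive_quadratic _ _ C) => s.
  have [s01|s01] := boolP (0 < s < 1); last first.
    by rewrite /bump (negbTE s01) normr0 mulr_ge0// sqr_ge0.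
  apply: (le_trans (pC _ s01)); rewrite ler_wpM2l//.
  move/andP: s01 => [s0 s1]; move: t01; rewrite negb_and -!leNgt => /orP[t0|t1].
  - rewrite ler_sqr ?nnegrE; nra.
  - rewrite -[leRHS]sqrrN opprB ler_sqr ?nnegrE; nra.
have w0 : t * (1 - t) != 0 by rewrite lt0r_neq0 ?mulr_gt0 ?subr_gt0.
pose w : R -> R := fun s => s * (1 - s).
apply: (@near_eq_is_derive _ _ _
    (horner p * (fun s => (w s)^-1) ^+ n * (expR \o (- (fun s => (w s)^-1))))).
  near=> s; have s01 : 0 < s < 1.
    by apply/andP; split; near: s; [exact: lt_nbhsr|exact: lt_nbhsl].
  by rewrite /bump s01 !fctE.
have dw : is_derive t 1 w (1 - t *+ 2).
  have -> : w = id * (cst 1 - id) by [].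
  apply: is_derive_eq; rewrite sub0r scalerN /= !fctE /=.
  rewrite -[t *: 1]/(t * 1) -[(1 - t) *: 1]/((1 - t) * 1); ring.
have dV : is_derive t 1 (fun s => (w s)^-1) (- w t ^- 2 *: (1 - t *+ 2)).
  exact: is_deriveV.
apply: is_derive_eq.
rewrite /bump t01 (exprS _ n.+1) (exprS _ n) /bump_deriv !hornerE !fctE /= -/(w t).
rewrite /GRing.scale /=.

have wt0 : w t != 0 by [].
have wE : t - t ^+ 2 = w t by rewrite /w; ring.
move: (w t) wt0 wE (expR _) => v v0 vE E.
have nE : n%:R * v^-1 ^+ n.-1 = n%:R * v * v^-1 ^+ n.
  by case: (n) => [|k] /=; [rewrite !mul0r|rewrite exprS -mulrA mulVKf].
rewrite nE; move: (v^-1 ^+ n) => z.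
rewrite vE (_ : t + t = 2 * t); last by ring.
by field.
Unshelve. all: by end_near. Qed.

Definition smooth f := forall k x, derivable (derive1n k f) x 1.

(** Each derivative of a bump is again a bump, and every bump is differentiable. *)
Lemma smooth_bump p n : smooth (bump p n).
Proof.
move=> k; have [q [m ->]] : exists q m, derive1n k (bump p n) = bump q m.
  elim: k => [|k [q [m kE]]]; first by exists p, n.
  exists (bump_deriv q m), m.+2; rewrite derive1nS kE; apply/funext => t.
  by rewrite derive1E; have [_ ->] := is_derive_bump q m t.
by move=> x; have [] := is_derive_bump q m x.
Qed.

Lemma smooth_continuous f : smooth f -> continuous f.
Proof.
by move=> sf x; apply: differentiable_continuous; apply/derivable1_diffP/(sf 0%N).
Qed.

Lemma smooth_derive1 f : smooth f -> smooth (derive1 f).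
Proof. by move=> sf k x; rewrite -derive1Sn; exact: sf. Qed.

Lemma smooth_antiderivative f g : (forall x : R, is_derive x 1 f (g x)) ->
  smooth g -> smooth f.
Proof.
move=> fg sg [|k] x; first by have [] := fg x.
rewrite derive1Sn (_ : derive1 f = g)//; apply/funext => t.
by rewrite derive1E; have [_ ->] := fg t.
Qed.

Lemma derive1n_affine (c x : R) f k : smooth f ->
  derive1n k (fun t => f (c * (t - x))) =
  (fun t => c ^+ k * derive1n k f (c * (t - x))).
Proof.
move=> sf; elim: k => [|k IH]; first by apply/funext => t; rewrite mul1r.
rewrite derive1nS IH; apply/funext => t.
have dk : is_derive (c * (t - x)) 1 (derive1n k f) (derive1n k.+1 f (c * (t - x))).
  by split; [exact: sf|rewrite derive1nS derive1E].
have da : is_derive t 1 (c \*: (id - cst x)) c.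
  by apply: is_derive_eq; rewrite subr0 -[LHS]/(c * 1) mulr1.
rewrite derive1E.
have -> : (fun t => c ^+ k * derive1n k f (c * (t - x))) =
    c ^+ k \*: (derive1n k f \o (c \*: (id - cst x))) by [].
rewrite derive_val.
rewrite exprS -[LHS]/(_ * _); ring.
Qed.

Lemma bump10_ge0 t : 0 <= bump 1 0 t.
Proof.
by rewrite /bump; case: ifP => // _; rewrite !hornerE ?expr0 ?mul1r expR_ge0.
Qed.

Lemma bump10_primitive : exists F : R -> R,
  (forall t : R, is_derive t 1 F (bump 1 0 t)) /\ (forall t, t <= 0 -> F t = 0).
Proof.
pose F (t : R) := (\int[@lebesgue_measure R]_(s in `[-1, t]) bump 1 0 s)%R.
have F0 t : t <= 0 -> F t = 0.
  move=> t0; rewrite /F -[RHS](@Rintegral_set0 _ _ R (@lebesgue_measure R) (bump 1 0)).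
  rewrite Rintegral_set0 Rintegral_mkcond (_ : _ \_ _ = cst 0).
    by rewrite Rintegral_cst// mul0r.
  apply/funext => s; rewrite /patch; case: ifP => //.
  rewrite inE /= in_itv/= /bump => /andP[_ st]; case: ifP => // /andP[s0 _].
  by move: (lt_le_trans s0 (le_trans st t0)); rewrite ltxx.
exists F; split => // t; have [t0|t0] := ltP t 0.
  rewrite /bump ltNge (ltW t0)/=.
  apply: (@near_eq_is_derive _ _ _ (cst 0)).
  by near=> s; rewrite F0// ltW//; near: s; exact: lt_nbhsl.
have cb := smooth_continuous (@smooth_bump 1 0).
have tt : t < t + 1 by rewrite ltrDl.
have t1 : -1 < t by rewrite (lt_le_trans _ t0)// ltrN10.
have ib : (@lebesgue_measure R).-integrable `[-1, t + 1] (EFin \o bump 1 0).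
  apply: continuous_compact_integrable; first exact: segment_compact.
  exact: continuous_subspaceT.
have [dF dFE] := continuous_FTC1_closed tt ib t1 (cb t).
by split; [exact: dF|rewrite -derive1E].
Unshelve. all: by end_near. Qed.

Lemma mean_value_increment (F f : R -> R) (x y : R) :
  (forall t : R, is_derive t 1 F (f t)) -> x < y ->
  exists2 c, x < c < y & F y - F x = f c * (y - x).
Proof.
move=> dF xy; have cF : {within `[x, y], continuous F}.
  apply: continuous_subspaceT => t; apply: differentiable_continuous.
  by apply/derivable1_diffP; have [] := dF t.
by have [c /[!in_itv]/= cxy E] := MVT xy (fun t _ => dF t) cF; exists c.
Qed.

(** The normalised primitive of the simplest bump.  Monotonicity and the plateau
    at 1 come from the mean value theorem. *)
Lemma smooth_step : exists S s : R -> R, exists M : R,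
  [/\ smooth S, (forall t : R, is_derive t 1 S (s t)),
      (forall t, t <= 0 -> S t = 0), (forall t, 1 <= t -> S t = 1) &
      [/\ forall t, 0 <= S t <= 1, forall t, 0 <= s t <= M &
          forall t, t <= 0 \/ 1 <= t -> s t = 0]].
Proof.
have [F [dF F0]] := bump10_primitive.
have F1 : 0 < F 1.
  have [c c01] := mean_value_increment dF ltr01; rewrite (F0 0)// !subr0 mulr1 => ->.
  rewrite /bump c01 !hornerE ?expr0 ?mul1r expR_gt0//.
have mF x y : x <= y -> F x <= F y.
  rewrite le_eqVlt => /predU1P[->//|xy]; rewrite -subr_ge0.
  by have [c _ ->] := mean_value_increment dF xy; rewrite mulr_ge0 ?bump10_ge0// subr_ge0 ltW.
have FE t : 1 <= t -> F t = F 1.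
  rewrite le_eqVlt => /predU1P[->//|t1]; apply/eqP; rewrite -subr_eq0.
  have [c /andP[c1 _] ->] := mean_value_increment dF t1.
  by rewrite /bump [c < 1]ltNge (ltW c1) andbF mul0r.
have dS t : is_derive t 1 ((F 1)^-1 \*: F) ((F 1)^-1 *: bump 1 0 t).
  exact: is_deriveZ.
have [C C0 bC] := bump_quadratic 1 0.
exists ((F 1)^-1 \*: F), (fun t => (F 1)^-1 * bump 1 0 t), ((F 1)^-1 * C).
split.
- apply: (@smooth_antiderivative _ (fun t => (F 1)^-1 * bump 1 0 t)) => //.
  have -> : (fun t => (F 1)^-1 * bump 1 0 t) = bump ((F 1)^-1 *: 1) 0.
    apply/funext => t; rewrite /bump; case: ifP => _; last by rewrite mulr0.
    by rewrite !hornerE /= expr0 !mulr1.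
  exact: (@smooth_bump _ _).
- exact: dS.
- by move=> t t0; rewrite -[LHS]/(_ * F t) (F0 t)// mulr0.
- by move=> t t0; rewrite -[LHS]/(_ * F t) (FE t)// mulVf// gt_eqF.
split.
- move=> t; rewrite -[_ t]/(_ * F t) mulr_ge0 ?invr_ge0 ?(ltW F1)//=; last first.
    have [t0|t0] := leP t 0; first by rewrite F0.
    by rewrite -(F0 0)// mF// ltW.
  rewrite ler_pdivrMl// mulr1; have [t1|t1] := leP 1 t; first by rewrite FE.
  by rewrite mF// ltW.
- move=> t; rewrite mulr_ge0 ?invr_ge0 ?(ltW F1) ?bump10_ge0//=.
  rewrite ler_wpM2l ?invr_ge0 ?(ltW F1)//.
  have [t01|t01] := boolP (0 < t < 1); last by rewrite /bump (negbTE t01).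
  rewrite (le_trans (ler_norm _))// (le_trans (bC _ t01))// ler_piMr//.
  by move/andP: t01 => [? ?]; rewrite exprn_ile1//; nra.
- move=> t [t0|t1]; rewrite /bump; first by rewrite ltNge t0/= mulr0.
  by rewrite [t < 1]ltNge t1/= andbF mulr0.
Qed.

End SmoothStep.

(** * The fundamental theorem of calculus for weak derivatives *)

Section WeakFTC.
Context {R : realType}.
Local Notation mu := (@lebesgue_measure R).
Implicit Types (f g : R -> R) (a b x y t : R).

Lemma smooth_affine f c x : smooth f -> smooth (fun t => f (c * (t - x))).
Proof.
move=> sf k t; rewrite derive1n_affine//.
have dk : is_derive (c * (t - x)) 1 (derive1n k f) (derive1n k.+1 f (c * (t - x))).
  by split; [exact: sf|rewrite derive1nS derive1E].
have -> : (fun t => c ^+ k * derive1n k f (c * (t - x))) =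
    c ^+ k \*: (derive1n k f \o (c \*: (id - cst x))) by [].
exact: ex_derive.
Qed.

Lemma smoothB f g : smooth f -> smooth g -> smooth (f - g).
Proof.
move=> sf sg k t; have -> : derive1n k (f - g) = derive1n k f - derive1n k g.
  elim: k => // k IH; rewrite !derive1nS IH; apply/funext => s.
  have df := sf k s; have dg := sg k s.
  by rewrite derive1E deriveB// !fctE !derive1E.
exact: derivableB.
Qed.

Lemma integrableM_continuous f g a b :
  mu.-integrable `[a, b] (EFin \o f) -> {within `[a, b], continuous g} ->
  mu.-integrable `[a, b] (EFin \o (fun t => f t * g t)).
Proof.
move=> fi cg; have mI : measurable (`[a, b] : set (measurableTypeR R)).
  exact: measurable_itv.
apply: (integrableMl mI fi).
- exact: subspace_continuous_measurable_fun.
- have /compact_bounded[M [_ mrt]] := continuous_compact cg (@segment_compact _ a b).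
  by exists M; split; rewrite ?num_real // => ? ? ? ?; exact: mrt.
Qed.

Lemma integrable_continuous f a b : {within `[a, b], continuous f} ->
  mu.-integrable `[a, b] (EFin \o f).
Proof. by apply: continuous_compact_integrable; exact: segment_compact. Qed.

Lemma Rintegral_is_derive (F f : R -> R) a b : a < b ->
  (forall t : R, is_derive t 1 F (f t)) -> continuous f ->
  \int[mu]_(t in `[a, b]) f t = F b - F a.
Proof.
move=> ab dF cf.
have cF : continuous F.
  move=> t; apply: differentiable_continuous; apply/derivable1_diffP.
  by have [] := dF t.
rewrite /Rintegral (@continuous_FTC2 _ f F)//.
- exact: continuous_subspaceT.
- split=> [t _||]; first by have [] := dF t.
  + exact/cvg_at_right_filter/cF.
  + exact/cvg_at_left_filter/cF.
- by move=> t _; rewrite derive1E; have [_ ->] := dF t.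
Qed.

Variables (S s : R -> R) (M : R).
Hypotheses (dS : forall t : R, is_derive t 1 S (s t)) (cs : continuous s)
  (S0 : forall t, t <= 0 -> S t = 0) (S1 : forall t, 1 <= t -> S t = 1)
  (sM : forall t, 0 <= s t <= M) (s0 : forall t, t <= 0 \/ 1 <= t -> s t = 0).

Let is_derive_step c x t :
  is_derive t 1 (fun t => S (c * (t - x))) (c * s (c * (t - x))).
Proof.
have da : is_derive t 1 (c \*: (id - cst x)) c.
  by apply: is_derive_eq; rewrite subr0 -[LHS]/(c * 1) mulr1.
by rewrite mulrC; apply: (@is_derive1_comp _ S (c \*: (id - cst x))).
Qed.

Let continuous_kernel c x : continuous (fun t => c * s (c * (t - x))).
Proof.
move=> t; apply: cvgM; first exact: cvg_cst.
apply: (@continuous_comp _ _ _ (fun t => c * (t - x)) s); last exact: cs.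
apply: cvgM; first exact: cvg_cst.
by apply: cvgB; [exact: cvg_id|exact: cvg_cst].
Qed.

Lemma Rintegral_kernel a b c x : 0 < c -> a < x -> x + c^-1 < b ->
  \int[mu]_(t in `[a, b]) (c * s (c * (t - x))) = 1.
Proof.
move=> c0 ax xb; have xb' : x < b by rewrite (lt_trans _ xb)// ltrDl invr_gt0.
rewrite (Rintegral_is_derive (lt_trans ax xb') (is_derive_step c x)
  (continuous_kernel (c := c) (x := x))).
rewrite S1; last by rewrite -ler_pdivrMl// mulr1 lerBrDl ltW.
by rewrite S0 ?subr0// pmulr_rle0// subr_le0 ltW.
Qed.

(** The kernel c s(c (t - x)) is a probability density bounded by c M and
    supported in the ball of radius 1/c, whose measure is 2/c; hence the factor
    2 M in front of the mean oscillation of f around x. *)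
Lemma kernel_davg f a b c x : mu.-integrable `[a, b] (EFin \o f) ->
  0 < c -> a < x -> x + c^-1 < b ->
  ((`|\int[mu]_(t in `[a, b]) (f t * (c * s (c * (t - x)))) - f x|)%:E <=
   (2 * M)%:E * davg (f \_ `[a, b]) x c^-1)%E.
Proof.
move=> fi c0 ax xb; have xb' : x < b by rewrite (lt_trans _ xb)// ltrDl invr_gt0.
have mI : measurable (`[a, b] : set (measurableTypeR R)) by exact: measurable_itv.
pose k t := c * s (c * (t - x)).
have ck : {within `[a, b], continuous k}.
  by apply: continuous_subspaceT; exact: continuous_kernel.
have fki := integrableM_continuous fi ck.
have ki := integrable_continuous ck.
have fxki := integrableZl mI (f x) ki.
have -> : \int[mu]_(t in `[a, b]) (f t * k t) - f x =
    \int[mu]_(t in `[a, b]) ((f t - f x) * k t).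
  rewrite -[X in _ - X]mulr1 -(Rintegral_kernel c0 ax xb) -RintegralZl//.
  by rewrite -RintegralB//; apply: eq_Rintegral => t _; rewrite mulrBl.
have fxk : mu.-integrable `[a, b] (EFin \o (fun t => (f t - f x) * k t)).
  apply: integrableM_continuous => //.
  have := integrableB mI fi (integrable_continuous
    (continuous_subspaceT (@cst_continuous _ _ (f x)) : {within `[a, b], continuous _})).
  by apply: eq_integrable.
rewrite EFin_normr_Rintegral// (le_trans (le_abse_integral _ _ _))//.
  exact: (measurable_int mu).
set F := f \_ `[a, b]; have mF : measurable_fun setT F.
  apply/(measurable_restrictT _ _).1 => //.
  by apply/measurable_EFinP; exact: (measurable_int mu).
have Fx : F x = f x by rewrite /F /patch mem_set//= in_itv/= !ltW.
have cV0 : 0 < c^-1 by rewrite invr_gt0.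
have mB : measurable (ball x c^-1 : set (measurableTypeR R)).
  exact: measurable_ball.
have M0 : 0 <= M by have /andP[] := sM 0; exact: le_trans.
have mFx : measurable_fun (ball x c^-1) (fun y => `|(F y - F x)%:E|%E).
  apply: measurableT_comp => //; apply/measurable_EFinP.
  by apply: measurable_funB => //; exact: measurable_funTS.
have mh : measurable_fun `[a, b] (fun t => `|((f t - f x) * k t)%:E|%E).
  by apply: measurableT_comp => //; exact: (measurable_int mu fxk).
rewrite /davg /iavg lebesgue_measure_ball ?(ltW cV0)// inver.
rewrite mulrn_eq0/= gt_eqF// muleA -EFinM.
have -> : (2 * M * (c^-1 *+ 2)^-1 = c * M) by field; rewrite gt_eqF.
rewrite -ge0_integralZl//; last by rewrite lee_fin mulr_ge0// ltW.
rewrite [leLHS]integral_mkcond [leRHS]integral_mkcond.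
apply: (ge0_le_integral mu measurableT) => //.
- by move=> t _; rewrite erestrict_ge0.
- apply/(measurable_restrictT _ _).1 => //; exact: mh.
- by apply/(measurable_restrictT _ _).1 => //; exact: measurable_funeM.
move=> t _; rewrite /patch /k; case: ifPn => [tab|_]; last first.
  by case: ifP => // _; rewrite mule_ge0// lee_fin mulr_ge0// ltW.
have [tx|tx] := leP t x.
  rewrite [s _]s0 ?mulr0 ?normr0; last by left; rewrite pmulr_rle0// subr_le0.
  by case: ifP => // _; rewrite mule_ge0// lee_fin mulr_ge0// ltW.
have [xt|xt] := leP (x + c^-1) t.
  rewrite [s _]s0 ?mulr0 ?normr0; last first.
    by right; rewrite -ler_pdivrMl// mulr1 lerBrDl.
  by case: ifP => // _; rewrite mule_ge0// lee_fin mulr_ge0// ltW.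
rewrite mem_set; last first.
  by rewrite -ball_normE /ball_/= distrC gtr0_norm ?subr_gt0// ltrBlDl.
rewrite /= Fx /F /patch tab -EFinM lee_fin normrM mulrC ler_wpM2r//.
have /andP[sc0 scM] := sM (c * (t - x)).
by rewrite ger0_norm ?mulr_ge0// ?ler_wpM2l// ltW.
Qed.

Lemma cvg_invS_at_right : (n.+1%:R : R)^-1 @[n --> \oo] --> (0 : R)^'+.
Proof.
move=> A [e /= e0 eA].
have h := (@cvgrPdist_lt _ _ _ _ _ (@harmonic R) 0).1 cvg_harmonic e e0.
change (\forall n \near \oo, A (n.+1%:R^-1)); near=> n.
by apply: eA => /=; [near: n; exact: h|rewrite invr_gt0].
Unshelve. all: by end_near.
Qed.

(** An approximate identity recovers the value of f at each Lebesgue point. *)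
Lemma cvg_kernel f a b x : mu.-integrable `[a, b] (EFin \o f) ->
  a < x -> x < b -> lebesgue_pt (f \_ `[a, b]) x ->
  \int[mu]_(t in `[a, b]) (f t * (n.+1%:R * s (n.+1%:R * (t - x)))) @[n --> \oo]
    --> f x.
Proof.
move=> fi ax xb fx.
pose u n := `|\int[mu]_(t in `[a, b])
  (f t * (n.+1%:R * s (n.+1%:R * (t - x)))) - f x|.
suff : (EFin \o u) n @[n --> \oo] --> 0%:E.
  by move=> /fine_cvg u0; apply/subr_cvg0; apply/norm_cvg0P; exact: u0.
apply: (@squeeze_cvge _ _ _ _ (cst 0%E) _
  (fun n => (2 * M)%:E * davg (f \_ `[a, b]) x (n.+1%:R)^-1)%E).
- near=> n; rewrite /= lee_fin normr_ge0/=; apply: kernel_davg => //.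
  rewrite -ltrBrDl; near: n; apply: (cvgr_lt 0); first exact: cvg_harmonic.
  by rewrite subr_gt0.
- exact: cvg_cst.
- rewrite -[X in _ --> X](mule0 (2 * M)%:E); apply: cvgeZl => //.
  exact: (cvg_comp _ _ cvg_invS_at_right fx).
Unshelve. all: by end_near. Qed.

(** The scaled steps tend to the indicator of t > x, also at t = x, since the
    step starts to rise only to the right of x. *)
Lemma cvg_step x t : S (n.+1%:R * (t - x)) @[n --> \oo] --> ((x < t)%R%:R : R).
Proof.
have [xt|tx] := ltP x t; last first.
  rewrite (_ : (fun n => _) = cst 0); first exact: cvg_cst.
  by apply/funext => n; rewrite S0// pmulr_rle0// subr_le0.
apply: cvg_near_cst; near=> n; rewrite S1// -ler_pdivrMr ?subr_gt0// mul1r.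
rewrite (@le_trans _ _ n%:R)// ?ler_nat//; near: n; exact: nbhs_infty_ger.
Unshelve. all: by end_near. Qed.

Hypotheses (sS : smooth S) (S01 : forall t, 0 <= S t <= 1).

(** A step up at x followed by a step down at y; the width 1/c of the second step
    must still fit before b. *)
Lemma test_function_steps a b c x y : 0 < c -> a < x -> x <= y -> y + c^-1 < b ->
  test_function a b (fun t => S (c * (t - x)) - S (c * (t - y))).
Proof.
move=> c0 ax xy yb; split; first by apply: smoothB; exact: smooth_affine.
exists x, (y + c^-1); split => // t; rewrite in_itv/= negb_and -!ltNge => /orP[tx|ty].
  have h z : x <= z -> c * (t - z) <= 0.
    by move=> xz; rewrite pmulr_rle0// subr_le0 (le_trans (ltW tx)).
  by rewrite !S0 ?subr0 ?h.
have h z : z <= y -> 1 <= c * (t - z).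
  by move=> zy; rewrite -ler_pdivrMl// mulr1 lerBrDl (le_trans _ (ltW ty))// lerD2r.
by rewrite !S1 ?subrr ?h.
Qed.

(** The differences of steps are bounded by 1 and converge to the indicator of
    ]x, y], so dominated convergence applies. *)
Lemma cvg_Rintegral_steps g a b x y : mu.-integrable `[a, b] (EFin \o g) ->
  a <= x -> x < y -> y <= b ->
  \int[mu]_(t in `[a, b]) (g t * (S (n.+1%:R * (t - x)) - S (n.+1%:R * (t - y))))
    @[n --> \oo] --> \int[mu]_(t in `[x, y]) g t.
Proof.
move=> gi ax xy yb.
have mI : measurable (`[a, b] : set (measurableTypeR R)) by exact: measurable_itv.
pose phi n t := S (n.+1%:R * (t - x)) - S (n.+1%:R * (t - y)).
have cphi n : {within `[a, b], continuous (phi n)}.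
  have cA z : continuous (fun t => S (n.+1%:R * (t - z))).
    exact: smooth_continuous (smooth_affine sS).
  by apply: continuous_subspaceT => t; apply: cvgB; exact: cA.
have gphi n : mu.-integrable `[a, b] (EFin \o (fun t => g t * phi n t)).
  exact: integrableM_continuous.
pose h t := g t * ((x < t)%R%:R - (y < t)%R%:R).
have hE : h = g \_ `]x, y].
  apply/funext => t; rewrite /h /patch mem_setE in_itv/=.
  have [xt|tx] := ltP x t; have [yt|ty] /= := ltP y t; rewrite ?subrr ?subr0 ?mulr0 ?mulr1//.
  by move: (lt_le_trans yt tx); rewrite ltNge (ltW xy).
have gxy : mu.-integrable `]x, y] (EFin \o g).
  apply: integrableS gi => //; apply: subset_itv; rewrite bnd_simp//.
have mh : measurable_fun `[a, b] (EFin \o h).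
  apply/measurable_EFinP; rewrite hE.
  apply: measurable_funTS; apply/(measurable_restrictT _ _).1 => //.
  by apply/measurable_EFinP; exact: (measurable_int mu gxy).
have [|||||hi _] := @dominated_convergence _ _ _ mu _ mI
    (fun n t => (g t * phi n t)%:E) (EFin \o h) (abse \o (EFin \o g)).
- by move=> n; exact: (measurable_int mu (gphi n)).
- exact: mh.
- apply: aeW => t _ /=; apply/fine_cvgP; split; first exact: nearW.
  by apply: cvgM; [exact: cvg_cst|apply: cvgB; exact: cvg_step].
- exact: integrable_abse.
- apply: aeW => t n _ /=; rewrite lee_fin normrM ler_piMr//.
  have := S01 (n.+1%:R * (t - x)); have := S01 (n.+1%:R * (t - y)).
  by rewrite ler_norml /phi; move=> /andP[? ?] /andP[? ?]; apply/andP; split; lra.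
move=> hc.
have -> : \int[mu]_(t in `[x, y]) g t = \int[mu]_(t in `[a, b]) h t.
  rewrite -Rintegral_itv_obnd_cbnd// hE -Rintegral_mkcondr; congr Rintegral.
  apply/seteqP; split => t /=; rewrite !in_itv/=; last by case.
  by move=> /andP[xt ty]; rewrite xt ty (ltW (le_lt_trans ax xt)) (le_trans ty yb).
apply: fine_cvg; rewrite fineK//.
exact: integrable_fin_num.
Qed.

(** Testing the weak derivative against a step up at x and down at y: the
    derivative of the test function is a difference of two approximate identities,
    and the test function itself tends to the indicator of ]x, y]. *)
Lemma weak_FTC_step f g a b x y :
  mu.-integrable `[a, b] (EFin \o f) -> mu.-integrable `[a, b] (EFin \o g) ->
  weak_derivative a b f g -> a < x -> x < y -> y < b ->
  lebesgue_pt (f \_ `[a, b]) x -> lebesgue_pt (f \_ `[a, b]) y ->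
  \int[mu]_(t in `[x, y]) g t = f y - f x.
Proof.
move=> fi gi fg ax xy yb fx fy.
have hk := cvgB (cvg_kernel fi (lt_trans ax xy) yb fy)
  (cvg_kernel fi ax (lt_trans xy yb) fx).
have hg := cvg_Rintegral_steps gi (ltW ax) xy (ltW yb).
pose k n z t := n.+1%:R * s (n.+1%:R * (t - z)).
have E : \forall n \near \oo,
    \int[mu]_(t in `[a, b]) (f t * k n y t) - \int[mu]_(t in `[a, b]) (f t * k n x t) =
    \int[mu]_(t in `[a, b]) (g t * (S (n.+1%:R * (t - x)) - S (n.+1%:R * (t - y)))).
  near=> n; have c0 : 0 < n.+1%:R :> R by [].
  have ynb : y + n.+1%:R^-1 < b.
    rewrite -ltrBrDl; near: n; apply: (cvgr_lt 0); first exact: cvg_harmonic.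
    by rewrite subr_gt0.
  have ck z : {within `[a, b], continuous (k n z)}.
    by apply: continuous_subspaceT; exact: continuous_kernel.
  apply: oppr_inj; rewrite -(fg _ (test_function_steps c0 ax (ltW xy) ynb)).
  rewrite opprB -RintegralB//; [|exact: integrableM_continuous..].
  apply: eq_Rintegral => t _; rewrite derive1E deriveB.
  - have [_ ->] := is_derive_step n.+1%:R x t.
    have [_ ->] := is_derive_step n.+1%:R y t.
    by rewrite /k; ring.
  - by have [] := is_derive_step n.+1%:R x t.
  - by have [] := is_derive_step n.+1%:R y t.
have hg' := cvg_trans (near_eq_cvg E) (hk _).
exact: (cvg_unique (@Rhausdorff R) hg (hg' _ _)).
Unshelve. all: by end_near. Qed.

End WeakFTC.

Section WeakFTCItv.
Context {R : realType}.
Local Notation mu := (@lebesgue_measure R).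
Implicit Types (f g : R -> R) (a b x y t : R).

(** Only Lebesgue points are required of x and y, so that the result also applies
    to a function f known up to a null set. *)
Lemma weak_FTC f g a b x y :
  mu.-integrable `[a, b] (EFin \o f) -> mu.-integrable `[a, b] (EFin \o g) ->
  weak_derivative a b f g -> a < x -> x < y -> y < b ->
  lebesgue_pt (f \_ `[a, b]) x -> lebesgue_pt (f \_ `[a, b]) y ->
  \int[mu]_(t in `[x, y]) g t = f y - f x.
Proof.
have [S [s [M [sS dS S0 S1 [S01 sM s0]]]]] := @smooth_step R.
apply: (weak_FTC_step (M := M) dS) => //.
apply: smooth_continuous; rewrite (_ : s = derive1 S); first exact: smooth_derive1.
by apply/funext => t; rewrite derive1E; have [_ ->] := dS t.
Qed.

Lemma RintegralB_itv g a b x y : mu.-integrable `[a, b] (EFin \o g) ->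
  a <= x -> x <= y -> y <= b ->
  \int[mu]_(t in `[a, y]) g t - \int[mu]_(t in `[a, x]) g t =
  \int[mu]_(t in `[x, y]) g t.
Proof.
move=> gi ax xy yb.
have gay : mu.-integrable `[a, y] (EFin \o g).
  by apply: integrableS gi => //; apply: subset_itv; rewrite bnd_simp.
rewrite Rintegral_itvB// ?bnd_simp//.
apply: Rintegral_itv_obnd_cbnd.
by apply: integrableS gay => //; apply: subset_itv; rewrite bnd_simp.
Qed.

Lemma lebesgue_pt_within_continuous f a b x : {within `[a, b], continuous f} ->
  a < x -> x < b -> lebesgue_pt (f \_ `[a, b]) x.
Proof.
move=> cf ax xb; have ab := lt_trans ax xb.
have /integrable_continuous fi := cf.
have mf : measurable_fun setT (f \_ `[a, b]).
  apply/(measurable_restrictT _ _).1 => //.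
  by apply/measurable_EFinP; exact: (measurable_int mu fi).
apply: cvg_at_right_filter.
have oU : open_nbhs x (`]a, b[ : set R).
  by split; [exact: interval_open|rewrite /= in_itv/= ax xb].
apply: (continuous_cvg_davg oU); first exact: measurable_itv.
  exact: measurable_funTS.
have /(continuous_within_itvP _ ab)[cfoo _ _] := cf.
have xab : x \in `]a, b[ by rewrite in_itv/= ax.
rewrite /prop_for /continuous_at {2}/patch mem_set/=; last first.
  by rewrite in_itv/= !ltW.
apply: cvg_trans (cfoo x xab); apply: near_eq_cvg; near=> z.
rewrite /patch mem_set//= in_itv/=; apply/andP.
by split; apply/ltW; near: z; [exact: lt_nbhsr|exact: lt_nbhsl].
Unshelve. all: by end_near. Qed.

(** Interior points of continuity are Lebesgue points; the end points follow since
    f minus the primitive of g is continuous on [a, b] and constant inside. *)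
Lemma weak_FTC_continuous f g a b x y : a < b ->
  {within `[a, b], continuous f} -> mu.-integrable `[a, b] (EFin \o g) ->
  weak_derivative a b f g -> a <= x -> x <= y -> y <= b ->
  \int[mu]_(t in `[x, y]) g t = f y - f x.
Proof.
move=> ab cf gi fg.
pose D x := f x - \int[mu]_(t in `[a, x]) g t.
have cD : {within `[a, b], continuous D}.
  have cg := parameterized_integral_continuous (ltW ab) gi.
  move: cf cg => /subspace_continuousP cf /subspace_continuousP cg.
  by apply/subspace_continuousP => z zab; apply: cvgB; [exact: cf|exact: cg].
have Dxy x' y' : a < x' -> x' < y' -> y' < b -> D x' = D y'.
  move=> ax xy yb.
  have := RintegralB_itv gi (ltW ax) (ltW xy) (ltW yb).
  rewrite (weak_FTC (integrable_continuous cf) gi fg ax xy yb) /D.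
    by move=> /eqP; rewrite subr_eq => /eqP ->; ring.
  - exact: lebesgue_pt_within_continuous (lt_trans xy yb).
  - exact: lebesgue_pt_within_continuous (lt_trans ax xy) yb.
have /(continuous_within_itvP _ ab)[_ Da Db] := cD.
pose c := (a + b) / 2; have [ac cb] : a < c /\ c < b by rewrite /c; split; lra.
have Dc x' : a < x' -> x' < b -> D x' = D c.
  move=> ax xb; have [xc|cx|->//] := ltgtP x' c; first exact: Dxy.
  by rewrite (Dxy c x').
have Dac : D a = D c.
  apply: (cvg_unique (@Rhausdorff R) Da); apply: cvg_near_cst.
  near=> z; apply: Dc; near: z; [exact: nbhs_right_gt|exact: nbhs_right_lt].
have Dbc : D b = D c.
  apply: (cvg_unique (@Rhausdorff R) Db); apply: cvg_near_cst.
  near=> z; apply: Dc; near: z; [exact: nbhs_left_gt|exact: nbhs_left_lt].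
have DE z : a <= z -> z <= b -> D z = D c.
  rewrite le_eqVlt => /predU1P[<-//|az]; rewrite le_eqVlt => /predU1P[->//|zb].
  exact: Dc.
move=> ax xy yb; rewrite -(RintegralB_itv gi)//.
have := DE _ ax (le_trans xy yb); rewrite -(DE _ (le_trans ax xy) yb) /D.
by move=> /eqP; rewrite subr_eq => /eqP ->; ring.
Unshelve. all: by end_near. Qed.

End WeakFTCItv.

(** * Square integrable functions and bounded functionals on H^2 *)

Section SquareIntegrable.
Context {R : realType}.
Local Notation mu := (@lebesgue_measure R).
Implicit Types (f g : R -> R) (a b x y t : R) (D : set (measurableTypeR R)).

Lemma integrable_mul_sqr D f g : measurable D ->
  measurable_fun D f -> measurable_fun D g ->
  mu.-integrable D (EFin \o (fun t => f t ^+ 2)) ->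
  mu.-integrable D (EFin \o (fun t => g t ^+ 2)) ->
  mu.-integrable D (EFin \o (fun t => f t * g t)).
Proof.
move=> mD mf mg fi gi; apply: (le_integrable mD _ _ (integrableD mD fi gi)).
  by apply/measurable_EFinP; exact: measurable_funM.
move=> t _; rewrite /= lee_fin [leRHS]ger0_norm ?addr_ge0 ?sqr_ge0//.
by rewrite ler_norml; have := sqr_ge0 (f t + g t); have := sqr_ge0 (f t - g t);
  move=> ? ?; apply/andP; split; nra.
Qed.

(** The quadratic polynomial s -> int (f + s g)^2 is nonnegative; it is evaluated
    at its minimum, and a large s treats the case int g^2 = 0. *)
Lemma cauchy_schwarz_Rintegral D f g : measurable D ->
  measurable_fun D f -> measurable_fun D g ->
  mu.-integrable D (EFin \o (fun t => f t ^+ 2)) ->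
  mu.-integrable D (EFin \o (fun t => g t ^+ 2)) ->
  (\int[mu]_(t in D) (f t * g t)) ^+ 2 <=
  \int[mu]_(t in D) (f t ^+ 2) * \int[mu]_(t in D) (g t ^+ 2).
Proof.
move=> mD mf mg fi gi; have fgi := integrable_mul_sqr mD mf mg fi gi.
set A := \int[mu]_(t in D) (f t ^+ 2); set B := \int[mu]_(t in D) (f t * g t).
set C := \int[mu]_(t in D) (g t ^+ 2).
have quad s : 0 <= A + s * B *+ 2 + s ^+ 2 * C.
  have -> : A + s * B *+ 2 + s ^+ 2 * C =
      \int[mu]_(t in D) ((f t ^+ 2 + (s *+ 2) * (f t * g t)) + s ^+ 2 * g t ^+ 2).
    rewrite (RintegralD mD (integrableD mD fi (integrableZl mD (s *+ 2) fgi))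
      (integrableZl mD (s ^+ 2) gi)).
    rewrite (RintegralD mD fi (integrableZl mD (s *+ 2) fgi)) !RintegralZl//.
    by rewrite mulrnAl.
  apply: Rintegral_ge0 => t _.
  rewrite (_ : _ + _ = (f t + s * g t) ^+ 2) ?sqr_ge0//; ring.
have A0 : 0 <= A by apply: Rintegral_ge0 => t _; exact: sqr_ge0.
have C0 : 0 <= C by apply: Rintegral_ge0 => t _; exact: sqr_ge0.
(* If C = 0 the polynomial is affine in s, hence negative somewhere if B != 0. *)
have [C00|Cneq0] := eqVneq C 0.
  rewrite C00 mulr0; have [->|Bneq0] := eqVneq B 0; first by rewrite expr0n.
  have := quad (- (A + 1) / B); rewrite C00 mulr0 addr0 divfK//; lra.
have Cgt0 : 0 < C by rewrite lt_def Cneq0.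
(* - B / C is the minimiser. *)
have h := mulr_ge0 (quad (- B / C)) (ltW Cgt0).
rewrite -subr_ge0; apply: le_trans h _; rewrite le_eqVlt; apply/orP; left.
by apply/eqP; field.
Qed.

End SquareIntegrable.

Section L2Facts.
Context {R : realType} (a b : R).
Local Notation mu := (@lebesgue_measure R).
Local Notation L2 := (L2 a b).
Local Notation energy g := (\int[mu]_(t in `[a, b]) (g t ^+ 2)).
Implicit Types (f g : R -> R) (x y t : R).

Lemma energy_ge0 g : 0 <= energy g.
Proof. by apply: Rintegral_ge0 => t _; exact: sqr_ge0. Qed.

Lemma L2_integrable f : L2 f -> mu.-integrable `[a, b] (EFin \o f).
Proof.
move=> Lf; have := L2_continuous_integrable Lf (@cst_continuous _ _ (1 : R)).
by apply: eq_integrable => //= t _; rewrite mulr1.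
Qed.

Lemma L2_integrableM f g : L2 f -> L2 g ->
  mu.-integrable `[a, b] (EFin \o (fun t => f t * g t)).
Proof.
move=> Lf Lg; apply: integrable_mul_sqr; first exact: measurable_itv.
- exact: L2_measurable.
- exact: L2_measurable.
- exact: L2_sqr_integrable.
- exact: L2_sqr_integrable.
Qed.

Lemma L2_cauchy_schwarz f g : L2 f -> L2 g ->
  (\int[mu]_(t in `[a, b]) (f t * g t)) ^+ 2 <= energy f * energy g.
Proof.
move=> Lf Lg; apply: cauchy_schwarz_Rintegral; first exact: measurable_itv.
- exact: L2_measurable.
- exact: L2_measurable.
- exact: L2_sqr_integrable.
- exact: L2_sqr_integrable.
Qed.

(** Cauchy-Schwarz against the constant 1 on [x, y]. *)
Lemma L2_Rintegral_itv g x y : L2 g -> a <= x -> x <= y -> y <= b ->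
  (\int[mu]_(t in `[x, y]) g t) ^+ 2 <= (y - x) * energy g.
Proof.
move=> Lg ax xy yb.
have sub : `[x, y] `<=` (`[a, b] : set R).
  by apply: subset_itv; rewrite bnd_simp.
have mxy : measurable (`[x, y] : set (measurableTypeR R)) by exact: measurable_itv.
have mab : measurable (`[a, b] : set (measurableTypeR R)) by exact: measurable_itv.
have g2i := L2_sqr_integrable Lg.
have g2i' := integrableS mab mxy sub g2i.
have mg : measurable_fun (`[x, y] : set (measurableTypeR R)) g.
  exact: measurable_funS (L2_measurable Lg).
have oneE : fine (mu `[x, y]) = y - x.
  rewrite lebesgue_measure_itv/= lte_fin; have [//|yx] := ltP.
  by rewrite (@le_anti _ _ x y) ?subrr// xy.
have := @cauchy_schwarz_Rintegral _ _ (cst 1) g mxy (measurable_cst _) mg.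
rewrite (_ : (fun t => cst 1 t ^+ 2) = cst (1 : R)); last first.
  by apply/funext => t; rewrite expr1n.
have i1 : mu.-integrable `[x, y] (EFin \o cst (1 : R)).
  apply: integrable_continuous; exact: continuous_subspaceT (@cst_continuous _ _ _).
move=> /(_ i1 g2i'); rewrite Rintegral_cst// mul1r oneE.
under eq_Rintegral do rewrite mul1r.
move=> /le_trans; apply; rewrite ler_wpM2l ?subr_ge0//.
rewrite /Rintegral fine_le//.
- exact: integrable_fin_num.
- exact: integrable_fin_num.
apply: ge0_subset_integral => //; first exact: (measurable_int mu g2i).
by move=> t _; rewrite lee_fin sqr_ge0.
Qed.

End L2Facts.

Section H1Facts.
Context {R : realType} (a b : R).
Hypothesis ab : a < b.
Local Notation mu := (@lebesgue_measure R).
Local Notation energy g := (\int[mu]_(t in `[a, b]) (g t ^+ 2)).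
Implicit Types (f g : R -> R) (x y t : R).

Lemma dist_itv_le x y : x \in `[a, b] -> y \in `[a, b] -> `|x - y| <= b - a.
Proof.
rewrite !in_itv/= ler_norml => /andP[? ?] /andP[? ?]; apply/andP; split; lra.
Qed.

(** H^1 functions of one variable are Hoelder continuous of exponent 1/2. *)
Lemma H1_oscillation f g x y : {within `[a, b], continuous f} -> L2 a b g ->
  weak_derivative a b f g -> x \in `[a, b] -> y \in `[a, b] ->
  (f y - f x) ^+ 2 <= `|y - x| * energy g.
Proof.
move=> cf Lg fg; rewrite !in_itv/=.
wlog xy : x y / x <= y => [h|].
  have [xy|/ltW yx] := leP x y; first exact: h.
  by move=> xab yab; rewrite -sqrrN opprB distrC h.
move=> /andP[ax _] /andP[_ yb].
rewrite ger0_norm ?subr_ge0//.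
by rewrite -(weak_FTC_continuous ab cf (L2_integrable Lg) fg)// L2_Rintegral_itv.
Qed.

(** The Sobolev embedding of H^1 into the bounded functions: f(x)^2 is at most
    2 f(t)^2 + 2 (b - a) int g^2 for each t, and this is averaged over t. *)
Lemma H1_pointwise f g x : {within `[a, b], continuous f} -> L2 a b f -> L2 a b g ->
  weak_derivative a b f g -> x \in `[a, b] ->
  (b - a) * f x ^+ 2 <= 2 * energy f + 2 * (b - a) ^+ 2 * energy g.
Proof.
move=> cf Lf Lg fg xab.
have mab : measurable (`[a, b] : set (measurableTypeR R)) by exact: measurable_itv.
have cstE (c : R) : \int[mu]_(t in `[a, b]) c = (b - a) * c.
  have muE : fine (mu `[a, b]) = b - a by rewrite lebesgue_measure_itv/= lte_fin ab.
  by rewrite Rintegral_cst// muE mulrC.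
have csti (c : R) : mu.-integrable `[a, b] (EFin \o cst c).
  by apply: integrable_continuous; exact: continuous_subspaceT (@cst_continuous _ _ _).
pose K := 2 * (b - a) * energy g.
have f2i := integrableZl mab 2 (L2_sqr_integrable Lf).
have : \int[mu]_(t in `[a, b]) (f x ^+ 2) <=
    \int[mu]_(t in `[a, b]) (2 * f t ^+ 2 + K).
  apply: le_Rintegral => //.
  - exact: csti.
  - exact: (integrableD mab f2i (csti K)).
  move=> t tab; have := H1_oscillation cf Lg fg tab xab.
  have := energy_ge0 a b g; have := dist_itv_le xab tab.
  rewrite /K; move: (energy g) => E le1 E0 h.
  have := le_trans h (ler_wpM2r E0 le1); have := sqr_ge0 (f x - 2 * f t). lra.
rewrite (RintegralD mab f2i (csti K)) !cstE RintegralZl//; last first.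
  exact: L2_sqr_integrable.
by move=> h; rewrite (le_trans h)// lerD2l /K le_eqVlt; apply/orP; left; apply/eqP; ring.
Qed.

End H1Facts.

Section H2Facts.
Context {R : realType} (a b : R).
Local Notation mu := (@lebesgue_measure R).
Local Notation energy g := (\int[mu]_(t in `[a, b]) (g t ^+ 2)).
Implicit Types (v w : H2 a b).

Lemma H2P v : H2_jet a b (H2_fun v : R -> R^o, H2_d1 v : R -> R^o, H2_d2 v : R -> R^o).
Proof.
have := H2valP v; move=> /asboolP; rewrite /H2_fun /H2_d1 /H2_d2.
by case: (H2val v) => -[].
Qed.

Lemma H2_L2 v : [/\ L2 a b (H2_fun v), L2 a b (H2_d1 v) & L2 a b (H2_d2 v)].
Proof. by have [] := H2P v. Qed.

Lemma H2_weak_derivative v : weak_derivative a b (H2_fun v) (H2_d1 v) /\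
  weak_derivative a b (H2_d1 v) (H2_d2 v).
Proof. by have [_ []] := H2P v. Qed.

Lemma H2_continuous v : {within `[a, b], continuous (H2_fun v)} /\
  {within `[a, b], continuous (H2_d1 v)}.
Proof. by have [_ []] := H2P v. Qed.

Lemma H2_funE c v w x : H2_fun (c *: v + w) x = c * H2_fun v x + H2_fun w x.
Proof. by []. Qed.

Lemma H2_d1E c v w x : H2_d1 (c *: v + w) x = c * H2_d1 v x + H2_d1 w x.
Proof. by []. Qed.

Lemma H2_d2E c v w x : H2_d2 (c *: v + w) x = c * H2_d2 v x + H2_d2 w x.
Proof. by []. Qed.

End H2Facts.

Section VectorFacts.
Context {R : realType} (a b : R).
Local Notation mu := (@lebesgue_measure R).
Local Notation energy g := (\int[mu]_(t in `[a, b]) (g t ^+ 2)).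
Implicit Types (u v w : H2v a b).

Lemma dotvE n (y z : 'cV[R]_n) : dotv y z = \sum_i y i 0 * z i 0.
Proof. by rewrite /dotv mxE; apply: eq_bigr => i _; rewrite mxE. Qed.

Lemma enorm2E n (y : 'cV[R]_n) : enorm y ^+ 2 = \sum_i y i 0 ^+ 2.
Proof.
rewrite /enorm sqr_sqrtr dotvE; first by apply: eq_bigr => i _; rewrite expr2.
by apply: sumr_ge0 => i _; rewrite -expr2 sqr_ge0.
Qed.

Lemma L2sqE (f : 'I_3 -> R -> R) : (forall i, L2 a b (f i)) ->
  L2sq a b (fun x => \col_i f i x) = \sum_i energy (f i).
Proof.
move=> Lf; rewrite /L2sq.
have mab : measurable (`[a, b] : set (measurableTypeR R)) by exact: measurable_itv.
have -> : \int[mu]_(x in `[a, b]) (enorm (\col_i f i x) ^+ 2) =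
    \int[mu]_(x in `[a, b]) ((f ord0 x ^+ 2 + f (lift ord0 ord0) x ^+ 2)
       + f (lift ord0 (lift ord0 ord0)) x ^+ 2).
  apply: eq_Rintegral => x _; rewrite enorm2E !big_ord_recl big_ord0 addr0 addrA.
  by rewrite !mxE.
have fi i := L2_sqr_integrable (Lf i).
rewrite (RintegralD mab (integrableD mab (fi _) (fi _)) (fi _)).
by rewrite (RintegralD mab (fi _) (fi _)) !big_ord_recl big_ord0 addr0 addrA.
Qed.

Lemma H2norm_sqr v : H2norm v ^+ 2 = \sum_i energy (H2_fun (v i)) +
  \sum_i energy (H2_d1 (v i)) + \sum_i energy (H2_d2 (v i)).
Proof.
rewrite /H2norm sqr_sqrtr; last first.
  rewrite !addr_ge0//; apply: Rintegral_ge0 => t _; exact: sqr_ge0.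
by congr (_ + _ + _); apply: L2sqE => i; have [] := H2_L2 (v i).
Qed.

Lemma H2norm_ge v i : energy (H2_fun (v i)) + energy (H2_d1 (v i)) +
  energy (H2_d2 (v i)) <= H2norm v ^+ 2.
Proof.
have le (F : 'I_3 -> R) : (forall j, 0 <= F j) -> F i <= \sum_j F j.
  by move=> F0; rewrite (bigD1 i)//= lerDl sumr_ge0.
by rewrite H2norm_sqr; apply: lerD; [apply: lerD|]; apply: le => j; exact: energy_ge0.
Qed.

(** Unbundled form of weak convergence, for functionals given as plain functions. *)
Lemma weak_cvg_linear (u_ : nat -> H2v a b) u (F : H2v a b -> R) : weak_cvg u_ u ->
  (forall c v w, F (c *: v + w) = c * F v + F w) ->
  (exists C, forall v, `|F v| <= C * H2norm v) -> F (u_ n) @[n --> \oo] --> F u.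
Proof.
move=> uu linF bF.
pose FL : {scalar (H2v a b)} := HB.pack F (GRing.isLinear.Build R (H2v a b) R _ F linF).
exact: (uu FL).
Qed.

Lemma H2norm_ge0 v : 0 <= H2norm v. Proof. exact: sqrtr_ge0. Qed.

Lemma bounded_functional (F : H2v a b -> R) (K : R) :
  (forall v, F v ^+ 2 <= K * H2norm v ^+ 2) ->
  exists C, forall v, `|F v| <= C * H2norm v.
Proof.
move=> FK; exists (Num.sqrt K) => v; rewrite -sqrtr_sqr (le_trans (ler_wsqrtr (FK v)))//.
have [K0|K0] := leP 0 K; first by rewrite sqrtrM// sqrtr_sqr ger0_norm ?H2norm_ge0.
rewrite (ler0_sqrtr (ltW K0)) mul0r -sqrtr0 ler_wsqrtr//.
by rewrite mulr_le0_ge0 ?sqr_ge0// ltW.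
Qed.

End VectorFacts.

Section PointEvaluation.
Context {R : realType} (a b : R).
Hypothesis ab : a < b.
Local Notation energy g := (\int[@lebesgue_measure R]_(t in `[a, b]) (g t ^+ 2)).

Let eval_bound (e e0 e1 n K : R) : 0 <= e0 -> 0 <= e1 -> 0 <= K ->
  (b - a) * e <= 2 * e0 + K * e1 -> e0 + e1 <= n ->
  e <= (b - a)^-1 * (2 + K) * n.
Proof.
move=> e00 e10 K0 h le; have ba : 0 < b - a by rewrite subr_gt0.
rewrite -mulrA ler_pdivlMl// (le_trans h)//.
by have := mulr_ge0 K0 e00; have := ler_wpM2l K0 le; nra.
Qed.

(** Point evaluations are bounded functionals on H^2, by the Sobolev embedding;
    the same holds for the point evaluations of the first derivative. *)
Lemma weak_cvg_H2_fun (u_ : nat -> H2v a b) u i x : weak_cvg u_ u -> x \in `[a, b] ->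
  H2_fun (u_ n i) x @[n --> \oo] --> H2_fun (u i) x.
Proof.
move=> uu xab; apply: (weak_cvg_linear (F := fun v => H2_fun (v i) x) uu).
  by move=> c v w; rewrite !ffunE.
apply: (bounded_functional (K := (b - a)^-1 * (2 + 2 * (b - a) ^+ 2))) => v.
have [L0 L1 L2] := H2_L2 (v i); have [w0 _] := H2_weak_derivative (v i).
have [c0 _] := H2_continuous (v i).
have := H2norm_ge v i; have := energy_ge0 a b (H2_d2 (v i)) => e2 le.
apply: eval_bound (H1_pointwise ab c0 L0 L1 w0 xab) _; try exact: energy_ge0.
  by rewrite mulr_ge0// sqr_ge0.
by rewrite (le_trans _ le)// lerDl.
Qed.

Lemma weak_cvg_H2_d1 (u_ : nat -> H2v a b) u i x : weak_cvg u_ u -> x \in `[a, b] ->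
  H2_d1 (u_ n i) x @[n --> \oo] --> H2_d1 (u i) x.
Proof.
move=> uu xab; apply: (weak_cvg_linear (F := fun v => H2_d1 (v i) x) uu).
  by move=> c v w; rewrite !ffunE.
apply: (bounded_functional (K := (b - a)^-1 * (2 + 2 * (b - a) ^+ 2))) => v.
have [L0 L1 L2] := H2_L2 (v i); have [_ w1] := H2_weak_derivative (v i).
have [_ c1] := H2_continuous (v i).
have := H2norm_ge v i; have := energy_ge0 a b (H2_fun (v i)) => e0 le.
apply: eval_bound (H1_pointwise ab c1 L1 L2 w1 xab) _; try exact: energy_ge0.
  by rewrite mulr_ge0// sqr_ge0.
by rewrite (le_trans _ le)// -addrA lerDr.
Qed.

End PointEvaluation.

(** * Partitions and nodal interpolation *)

Section Partition.
Context {R : realType}.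
Local Notation mu := (@lebesgue_measure R).
Implicit Types (f : R -> R) (z t c : R) (s : seq R).

(** The cell found is the leftmost one containing t, so t lies strictly to the
    right of p unless t is the left end point of the partition. *)
Lemma partition_cell z s t : path <%R z s -> z < last z s ->
  z <= t -> t <= last z s ->
  exists i p q, [/\ (i < size s)%N, p = (z :: s)`_i & q = s`_i] /\
    [/\ p < q, p <= t, t <= q, z < t -> p < t & q - p <= mesh z s] /\
    forall f, interp1 f z s t = f p + (f q - f p) / (q - p) * (t - p).
Proof.
elim: s z => [|x1 s IH] z /=; first by rewrite ltxx.
move=> /andP[x01 ps] _ xt tl; rewrite /mesh/= big_cons.
have [tx1|x1t] := leP t x1.
  exists 0%N, z, x1; split=> //; split.
    by split => //; rewrite le_max lexx.
  by [].
have x1l := lt_le_trans x1t tl.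
have [i [p [q [[is_ -> ->] [[pq pt tq ptlt pqm] fE]]]]] := IH x1 ps x1l (ltW x1t) tl.
exists i.+1, (x1 :: s)`_i, s`_i; split => //; split.
  split => //; last by rewrite le_max pqm orbT.
  by move=> _; exact: ptlt.
by [].
Qed.

Lemma path_le_last z s : path <%R z s -> z <= last z s.
Proof.
by elim: s z => //= x1 s IH z /andP[/ltW zx1 /IH]; exact: le_trans.
Qed.

Lemma mesh_le_itv z s : path <%R z s -> mesh z s <= last z s - z.
Proof.
elim: s z => [|x1 s IH] z /=; first by rewrite /mesh big_nil subrr.
move=> /andP[zx1 ps]; have := IH _ ps; have := path_le_last ps.
rewrite {2}/mesh/= big_cons -/(mesh x1 s) => le0 le1.
by rewrite ge_max; apply/andP; split; lra.
Qed.

Lemma measurable_interp1 f z s : measurable_fun setT (interp1 f z s).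
Proof.
elim: s z => [|x1 s IH] z /=; first exact: measurable_cst.
apply: measurable_fun_ifT => //.
  by apply: measurable_fun_ler => //; exact: measurable_cst.
apply: measurable_funD; first exact: measurable_cst.
apply: measurable_funM; first exact: measurable_cst.
by apply: measurable_funB => //; exact: measurable_cst.
Qed.

Variables (a b : R) (s : seq R).
Hypotheses (ab : a < b) (abs : itv_partition a b s).

Lemma itv_partition_cell t : t \in `[a, b] ->
  exists i p q, [/\ (i < size s)%N, p = (a :: s)`_i & q = s`_i] /\
    [/\ p < q, p <= t, t <= q, a < t -> p < t & q - p <= mesh a s] /\
    forall f, interp1 f a s t = f p + (f q - f p) / (q - p) * (t - p).
Proof.
have [ps /eqP lE] := abs; rewrite in_itv/= => /andP[at_ tb].
by apply: partition_cell; rewrite ?lE.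
Qed.

Lemma itv_partition_mem x : x \in a :: s -> x \in `[a, b].
Proof.
have [ps /eqP lE] := abs; rewrite in_itv/=.
move: ps lE; rewrite path_sortedE; last exact: lt_trans.
move=> /andP[/allP la ss] lE; rewrite inE => /predU1P[->|xs]; first by rewrite lexx ltW.
rewrite ltW ?la//=.
have : s != [::] by case: (s) xs.
rewrite -lE; move: ss xs; case/lastP: (s) => // s' y; rewrite last_rcons.
rewrite -cats1 => ss; rewrite mem_cat inE => /orP[xs|/eqP->//] _.
move: ss; rewrite sorted_pairwise; last exact: lt_trans.
by rewrite pairwise_cat allrel1r => /andP[/allP/(_ x xs) /ltW].
Qed.

Lemma interp1_between f t (lo hi : R) : t \in `[a, b] ->
  (forall x, x \in a :: s -> `|x - t| <= mesh a s -> lo <= f x <= hi) ->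
  lo <= interp1 f a s t <= hi.
Proof.
move=> /itv_partition_cell[i [p [q [[is_ pE qE] [[pq pt tq _ pqm] ->]]]]] fx.
have ps : p \in a :: s by rewrite pE mem_nth//= ltnW.
have qs : q \in a :: s by rewrite qE inE mem_nth// orbT.
have /andP[? ?] : lo <= f p <= hi.
  by apply: fx => //; rewrite ler0_norm ?subr_le0//; lra.
have /andP[? ?] : lo <= f q <= hi.
  by apply: fx => //; rewrite ger0_norm ?subr_ge0//; lra.
have th0 : 0 <= (t - p) / (q - p) by rewrite divr_ge0// subr_ge0// ltW.
have th1 : (t - p) / (q - p) <= 1 by rewrite ler_pdivrMr ?subr_gt0// mul1r lerD2r.
rewrite -mulrA [_^-1 * _]mulrC; move: (_ / _) th0 th1 => th th0 th1.
nra.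
Qed.

Lemma interp1_ge0 f t : (forall x, 0 <= f x) -> t \in `[a, b] ->
  0 <= interp1 f a s t <= \sum_(x <- a :: s) f x.
Proof.
move=> f0 tab; apply: interp1_between => // x xs _; rewrite f0/=.
by rewrite (big_rem x)//= lerDl sumr_ge0.
Qed.

Lemma integrable_interp1 f : (forall x, 0 <= f x) ->
  mu.-integrable `[a, b] (EFin \o interp1 f a s).
Proof.
move=> f0; apply: measurable_bounded_integrable => //.
- by rewrite /= lebesgue_measure_itv/= lte_fin ab ltry.
- by apply: measurable_funTS; exact: measurable_interp1.
exists (\sum_(x <- a :: s) f x); split; first exact: num_real.
move=> M ltM t /= tab; have /andP[it0 itM] := interp1_ge0 f0 tab.
by rewrite ger0_norm// (le_trans itM)// ltW.
Qed.

(** The interpolant at t in [y, z] only sees nodes at distance at most the mesh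
    size from t, hence the enlargement of [y, z] in the hypothesis. *)
Lemma le_Rintegral_interp1 f c y z : (forall x, 0 <= f x) -> 0 <= c ->
  a <= y -> y <= z -> z <= b ->
  (forall x, x \in `[a, b] -> y - mesh a s <= x -> x <= z + mesh a s -> c <= f x) ->
  c * (z - y) <= \int[mu]_(t in `[a, b]) interp1 f a s t.
Proof.
move=> f0 c0 ay yz zb fc.
have sub : `[y, z] `<=` (`[a, b] : set R).
  by apply: subset_itv; rewrite bnd_simp.
have mab : measurable (`[a, b] : set (measurableTypeR R)) by exact: measurable_itv.
have myz : measurable (`[y, z] : set (measurableTypeR R)) by exact: measurable_itv.
have Ii := integrable_interp1 f0.
have Ii' := integrableS mab myz sub Ii.
apply: (@le_trans _ _ (\int[mu]_(t in `[y, z]) interp1 f a s t)).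
  have yzE : fine (mu `[y, z]) = z - y.
    rewrite lebesgue_measure_itv/= lte_fin; have [//|zy] := ltP.
    by rewrite (@le_anti _ _ y z) ?subrr// yz.
  rewrite -yzE -Rintegral_cst//; apply: le_Rintegral => //.
    by apply: integrable_continuous; exact: continuous_subspaceT (@cst_continuous _ _ _).
  move=> t tyz; have tab : t \in `[a, b] by exact: sub.
  have [i [p [q [[is_ pE qE] [[pq pt tq _ pqm] iE]]]]] := itv_partition_cell tab.
  have := @interp1_between f t c (\sum_(x <- a :: s) f x) tab.
  move=> /(_ _)/andP[]// x xs xt; rewrite (big_rem x)//= lerDl sumr_ge0// andbT.
  move: tyz xt; rewrite /= in_itv/= ler_norml => /andP[yt tz] /andP[x1 x2].
  by apply: fc; [exact: itv_partition_mem|lra|lra].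
rewrite /Rintegral fine_le//.
- exact: integrable_fin_num.
- exact: integrable_fin_num.
apply: ge0_subset_integral => //; first exact: (measurable_int mu Ii).
by move=> t tab; rewrite lee_fin; have /andP[] := interp1_ge0 f0 tab.
Qed.

End Partition.

(** * Limits of discrete deformations with bounded energy *)

Section Confinement.
Context {R : realType} (m : nat) (G : 'I_m -> 'M[R]_3).
Implicit Types y : 'cV[R]_3.

Lemma VD_ge0 y : 0 <= VD G y.
Proof. by apply: sumr_ge0 => r _; rewrite mulr_ge0// sqr_ge0. Qed.

Lemma VD_confinement y : confinement G y -> VD G y = 0.
Proof.
move=> Dy; apply: big1 => r _; rewrite (_ : Num.max _ _ = 0) ?expr0n ?mulr0//.
apply/max_idPr; rewrite subr_le0 -[leRHS]sqrtr1 ler_wsqrtr//.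
exact: Dy.
Qed.

Lemma cvg_sum_ord n (T : Type) (F : set_system T) {FF : Filter F}
    (f : 'I_n -> T -> R) (l : 'I_n -> R) :
  (forall i, f i t @[t --> F] --> l i) ->
  \sum_i f i t @[t --> F] --> \sum_i l i.
Proof.
move=> fl; elim: n f l fl => [|n IH] f l fl.
  by rewrite big_ord0; under eq_fun do rewrite big_ord0; exact: cvg_cst.
rewrite big_ord_recl; under eq_fun do rewrite big_ord_recl.
by apply: cvgD; [exact: fl|apply: IH => i; exact: fl].
Qed.

(** A violated constraint has a quadratic form above 1, which stays above a
    constant larger than 1 nearby by continuity; a single violated constraint
    already bounds the sum from below. *)
Lemma VD_bounded_below_near y0 : ~ confinement G y0 -> exists eta c, [/\ 0 < eta, 0 < c &
  forall y, (forall i, `|y i 0 - y0 i 0| < eta) -> c <= VD G y].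
Proof.
move=> /existsNP[r /not_implyP[_ /negP]]; rewrite -ltNge => Q1.
pose Q y := dotv y (G r *m y); have {}Q1 : 1 < Q y0 by [].
set q := Q y0 in Q1 *.
have cQ : Q y @[y --> y0] --> Q y0.
  rewrite /Q; under eq_fun do rewrite dotvE; rewrite dotvE.
  apply: (cvg_sum_ord (FF := nbhs_filter y0)) => i; apply: cvgM; first exact: coord_continuous.
  under eq_fun do rewrite mxE; rewrite mxE.
  apply: (cvg_sum_ord (FF := nbhs_filter y0)) => j; apply: cvgM; first exact: cvg_cst.
  exact: coord_continuous.
have : \forall y \near y0, (1 + q) / 2 < Q y.
  by apply: (cvgr_gt (Q y0) cQ); rewrite -/q; lra.
move=> /nbhs_ballP[eta /= eta0 etaQ].
pose c := 2^-1 * (Num.sqrt ((1 + q) / 2) - 1) ^+ 2.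
have q1 : 1 < Num.sqrt ((1 + q) / 2).
  by rewrite -[ltLHS]sqrtr1 ltr_sqrt; lra.
exists eta, c; split => //.
  by rewrite mulr_gt0// exprn_gt0// subr_gt0.
move=> y yy0; have {etaQ}/ltW Qy : (1 + q) / 2 < Q y.
  by apply: etaQ; split => // i j; rewrite ord1 -ball_normE /ball_/= distrC.
rewrite /VD (bigD1 r)//= -[leLHS]addr0 lerD//; last first.
  by apply: sumr_ge0 => k _; rewrite mulr_ge0// sqr_ge0.
rewrite ler_wpM2l//; have := ler_wsqrtr Qy; rewrite -/(qnorm _ _) => le.
have le1 : Num.sqrt ((1 + q) / 2) - 1 <= Num.max (qnorm (G r) y - 1) 0.
  by rewrite le_max lerD2r le.
by rewrite ler_sqr ?nnegrE ?subr_ge0 ?(ltW q1)// (le_trans _ le1)// subr_ge0 ltW.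
Qed.

End Confinement.

Section LowerBound.
Context {R : realType} (a b : R) (ab : a < b) (m : nat) (G : 'I_m -> 'M[R]_3).
Context (l : nat) (Lbc : {linear H2v a b -> 'cV[R]_l}) (lbc : 'cV[R]_l).
Hypothesis Lbc_bounded : bounded_op Lbc.
Context (kappa : R) (kappa_gt0 : 0 < kappa).
Local Notation mu := (@lebesgue_measure R).
Local Notation energy g := (\int[mu]_(t in `[a, b]) (g t ^+ 2)).
Local Notation bend u := (\sum_i energy (H2_d2 (u i))).

Lemma bend_ge0 (u : H2v a b) : 0 <= bend u.
Proof. by apply: sumr_ge0 => i _; exact: energy_ge0. Qed.

Lemma bendE (u : H2v a b) : \int[mu]_(x in `[a, b]) (enorm (vd2 u x) ^+ 2) = bend u.
Proof. by apply: L2sqE => i; have [] := H2_L2 (u i). Qed.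

(** Errors are estimated through their squares throughout; this turns such an
    estimate into convergence. *)
Lemma sqr_cvg0 (e d : nat -> R) : e n @[n --> \oo] --> 0 ->
  (forall n, d n ^+ 2 <= e n) -> d n @[n --> \oo] --> 0.
Proof.
move=> e0 de; apply/cvgrPdist_lt => eps eps0.
have : \forall n \near \oo, e n < eps ^+ 2 by apply: (cvgr_lt 0 e0); rewrite exprn_gt0.
apply: filterS => n en; rewrite sub0r normrN -ltr_sqr ?nnegrE ?(ltW eps0)//.
by rewrite real_normK ?num_real// (le_lt_trans (de n)).
Qed.

Context (s : nat -> seq R) (u_ : nat -> H2v a b) (u : H2v a b) (eps : nat -> R) (K : R).
Hypotheses (s_part : forall n, itv_partition a b (s n))
  (mesh0 : mesh a (s n) @[n --> \oo] --> 0)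
  (eps_gt0 : forall n, 0 < eps n) (eps0 : eps n @[n --> \oo] --> 0)
  (u_u : weak_cvg u_ u) (u_adm : forall n, admissible_h Lbc lbc (s n) (u_ n))
  (EK : forall n, kappa / 2 * bend (u_ n) + (2 * eps n)^-1 *
    \int[mu]_(x in `[a, b]) (interp1 (fun t => VD G (vfun (u_ n) t)) a (s n) x) <= K).
Local Notation penalty n :=
  (\int[mu]_(x in `[a, b]) (interp1 (fun t => VD G (vfun (u_ n) t)) a (s n) x)).

Lemma penalty_ge0 n : 0 <= penalty n.
Proof.
apply: Rintegral_ge0 => t tab.
by have /andP[] := @interp1_ge0 _ a b (s n) ab (s_part n) (fun t => VD G (vfun (u_ n) t)) t
  (fun x => VD_ge0 _ _) tab.
Qed.

Lemma bend_bounded n : bend (u_ n) <= 2 / kappa * K.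
Proof.
rewrite mulrAC ler_pdivlMr//.
have : 0 <= (2 * eps n)^-1 * penalty n.
  by rewrite mulr_ge0 ?penalty_ge0// invr_ge0 mulr_ge0// ltW.
by have := EK n; lra.
Qed.

Lemma penalty_bounded n : penalty n <= 2 * eps n * K.
Proof.
have e0 : 0 < 2 * eps n by rewrite mulr_gt0.
rewrite -ler_pdivrMl// (le_trans _ (EK n))// lerDr mulr_ge0 ?bend_ge0//.
by rewrite divr_ge0// ltW.
Qed.

Let C := 2 / kappa * K.

Lemma C_ge0 : 0 <= C. Proof. exact: le_trans (bend_ge0 _) (bend_bounded 0). Qed.

Lemma d1_oscillation n i x y : x \in `[a, b] -> y \in `[a, b] ->
  (H2_d1 (u_ n i) y - H2_d1 (u_ n i) x) ^+ 2 <= `|y - x| * C.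
Proof.
move=> xab yab; have [_ _ L2d2] := H2_L2 (u_ n i).
have [_ w] := H2_weak_derivative (u_ n i); have [_ c] := H2_continuous (u_ n i).
apply: (le_trans (H1_oscillation ab c L2d2 w xab yab)).
rewrite ler_wpM2l// (le_trans _ (bend_bounded n))// (bigD1 i)//= lerDl sumr_ge0//.
by move=> j _; exact: energy_ge0.
Qed.

Lemma near_node n x : x \in `[a, b] ->
  exists2 p, p \in a :: s n & `|x - p| <= mesh a (s n).
Proof.
move=> xab; have [i [p [q [[is_ pE qE] [[pq px xq _ qp] _]]]]] :=
  itv_partition_cell ab (s_part n) xab.
exists p; first by rewrite pE mem_nth//= ltnW.
by rewrite ger0_norm ?subr_ge0// (le_trans _ qp)// lerD2r.
Qed.

Lemma d1_node n p : p \in a :: s n -> \sum_i H2_d1 (u_ n i) p ^+ 2 = 1.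
Proof.
move=> ps; have [_ /(_ p ps) + _] := u_adm n.
by rewrite enorm2E => <-; apply: eq_bigr => i _; rewrite mxE.
Qed.

(** The derivative has length 1 at a node within mesh distance of x; the uniform
    Hoelder bound moves the value to x, and point evaluations of the derivatives
    converge along the sequence. *)
Lemma limit_unit x : x \in `[a, b] -> enorm (vd1 u x) = 1.
Proof.
move=> xab; suff E : enorm (vd1 u x) ^+ 2 = 1.
  by rewrite -[LHS]ger0_norm ?sqrtr_ge0// -sqrtr_sqr E sqrtr1.
have /choice[p pP] n : exists p, p \in a :: s n /\ `|x - p| <= mesh a (s n).
  by have [p ? ?] := near_node n xab; exists p.
have pab n : p n \in `[a, b].
  by apply: (itv_partition_mem ab (s_part n)); have [] := pP n.
have d0 i : H2_d1 (u_ n i) x - H2_d1 (u_ n i) (p n) @[n --> \oo] --> 0.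
  apply: (@sqr_cvg0 (fun n => mesh a (s n) * C)).
    by rewrite -[X in _ --> X](mul0r C); apply: cvgM => //; exact: cvg_cst.
  move=> n; apply: (le_trans (d1_oscillation _ _ (pab n) xab)).
  by rewrite ler_wpM2r ?C_ge0//; have [] := pP n.
have dp i : H2_d1 (u_ n i) (p n) @[n --> \oo] --> H2_d1 (u i) x.
  have : H2_d1 (u_ n i) x - (H2_d1 (u_ n i) x - H2_d1 (u_ n i) (p n)) @[n --> \oo]
      --> H2_d1 (u i) x - 0.
    by apply: cvgB; [exact: weak_cvg_H2_d1|exact: d0].
  by rewrite subr0; under eq_fun do rewrite subKr.
rewrite enorm2E; under eq_bigr do rewrite mxE.
have : \sum_i H2_d1 (u_ n i) (p n) ^+ 2 @[n --> \oo] --> \sum_i H2_d1 (u i) x ^+ 2.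
  by apply: (@cvg_sum_ord R 3) => i; rewrite expr2; under eq_fun do rewrite expr2; exact: cvgM.
rewrite (_ : (fun n => _) = cst 1); last first.
  by apply/funext => n; apply: d1_node; have [] := pP n.
by move=> h; apply: (cvg_unique (@Rhausdorff R) h); exact: cvg_cst.
Qed.

(** The components of a bounded linear operator are weakly continuous. *)
Lemma limit_boundary : Lbc u = lbc.
Proof.
apply/colP => j; have [B LB] := Lbc_bounded.
have h := weak_cvg_linear (F := fun v => Lbc v j 0) u_u.
have : Lbc (u_ n) j 0 @[n --> \oo] --> Lbc u j 0.
  apply: h; first by move=> c v w; rewrite linearP !mxE.
  exists B => v; apply: le_trans (LB v).
  rewrite -ler_sqr ?nnegrE ?sqrtr_ge0// enorm2E real_normK ?num_real//.
  by rewrite (bigD1 j)//= lerDl sumr_ge0// => k _; exact: sqr_ge0.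
rewrite (_ : (fun n => _) = cst (lbc j 0)); last first.
  by apply/funext => n; have [_ _ ->] := u_adm n.
by move=> {}h; apply: (cvg_unique (@Rhausdorff R) h); exact: cvg_cst.
Qed.

(** Weak lower semicontinuity of the square norm: the functional
    v -> int u'' v'' is weakly continuous, and 2 u'' v'' <= (u'')^2 + (v'')^2. *)
Lemma limit_bend : bend u <= C.
Proof.
have h i : \int[mu]_(t in `[a, b]) (H2_d2 (u i) t * H2_d2 (u_ n i) t) @[n --> \oo] -->
    \int[mu]_(t in `[a, b]) (H2_d2 (u i) t * H2_d2 (u i) t).
  have [_ _ L] := H2_L2 (u i).
  have mab : measurable (`[a, b] : set (measurableTypeR R)) by exact: measurable_itv.
  apply: (weak_cvg_linear
    (F := fun v => \int[mu]_(t in `[a, b]) (H2_d2 (u i) t * H2_d2 (v i) t)) u_u).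
    move=> c v w; have [_ _ Lv] := H2_L2 (v i); have [_ _ Lw] := H2_L2 (w i).
    have vi := L2_integrableM L Lv; have wi := L2_integrableM L Lw.
    rewrite -RintegralZl// -RintegralD//.
      by apply: eq_Rintegral => t _; rewrite !ffunE H2_d2E mulrDr mulrCA.
    exact: (integrableZl mab c vi).
  apply: (bounded_functional (K := energy (H2_d2 (u i)))) => v.
  have [_ _ Lv] := H2_L2 (v i).
  apply: (le_trans (L2_cauchy_schwarz L Lv)); rewrite ler_wpM2l ?energy_ge0//.
  by rewrite (le_trans _ (H2norm_ge v i))// lerDr addr_ge0 ?energy_ge0.
have {}h : \sum_i \int[mu]_(t in `[a, b]) (H2_d2 (u i) t * H2_d2 (u_ n i) t) @[n --> \oo]
    --> \sum_i \int[mu]_(t in `[a, b]) (H2_d2 (u i) t * H2_d2 (u i) t).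
  exact: cvg_sum_ord.
have : \sum_i \int[mu]_(t in `[a, b]) (H2_d2 (u i) t * H2_d2 (u i) t) <= (bend u + C) / 2.
  refine (cvgr_to_le h _); apply: nearW => n.
  pose S := \sum_i (energy (H2_d2 (u i)) + energy (H2_d2 (u_ n i))).
  rewrite ler_pdivlMr// mulr_suml (le_trans (y := S))//.
    apply: ler_sum => i _.
    have [_ _ L] := H2_L2 (u i); have [_ _ Ln] := H2_L2 (u_ n i).
    have mab : measurable (`[a, b] : set (measurableTypeR R)) by exact: measurable_itv.
    have LL := L2_integrableM L Ln.
    have L2 := L2_sqr_integrable L; have Ln2 := L2_sqr_integrable Ln.
    rewrite -RintegralZr// -RintegralD//; apply: le_Rintegral => //.
    + exact: (integrableZr mab 2 LL).
    + exact: (integrableD mab L2 Ln2).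
    by move=> t _; have := sqr_ge0 (H2_d2 (u i) t - H2_d2 (u_ n i) t); nra.
  by rewrite /S big_split/= lerD2l bend_bounded.
under eq_bigr do under eq_Rintegral do rewrite -expr2.
by rewrite ler_pdivlMr// mulr_natr mulr2n lerD2l.
Qed.

(** If u(x) violated a constraint, then the potential along the sequence would be
    at least c on a fixed interval around x, because the functions are uniformly
    Hoelder continuous and converge at x.  The integral of the interpolated
    potential would then be bounded below, while it is at most 2 eps K. *)
Lemma limit_confined x : x \in `[a, b] -> confinement G (vfun u x).
Proof.
move=> xab; apply: contrapT => /VD_bounded_below_near[eta [c [eta0 c0 VDc]]].
(* B bounds the energies of the first derivatives: at the nearest node each
   component is at most 1, and d1_oscillation bounds the change from there. *)
pose B := (b - a) * (2 + 2 * (b - a) * C).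
have ba : 0 < b - a by rewrite subr_gt0.
have B0 : 0 <= B by rewrite mulr_ge0 ?(ltW ba)// addr_ge0// mulr_ge0 ?C_ge0// mulr_ge0// ltW.
have mesh_le n : mesh a (s n) <= b - a.
  by have [ps /eqP lE] := s_part n; have := mesh_le_itv ps; rewrite lE.
have osc n i y : y \in `[a, b] ->
    (H2_fun (u_ n i) y - H2_fun (u_ n i) x) ^+ 2 <= `|y - x| * B.
  move=> yab; have [_ L1 _] := H2_L2 (u_ n i).
  have [w _] := H2_weak_derivative (u_ n i); have [cu _] := H2_continuous (u_ n i).
  apply: (le_trans (H1_oscillation ab cu L1 w xab yab)); rewrite ler_wpM2l//.
  have mab : measurable (`[a, b] : set (measurableTypeR R)) by exact: measurable_itv.
  have -> : B = \int[mu]_(t in `[a, b]) (2 + 2 * (b - a) * C).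
    have E : fine (mu `[a, b]) = b - a by rewrite lebesgue_measure_itv/= lte_fin ab.
    by rewrite Rintegral_cst// E mulrC.
  apply: le_Rintegral => //.
  - exact: L2_sqr_integrable.
  - by apply: integrable_continuous; exact: continuous_subspaceT (@cst_continuous _ _ _).
  move=> t tab; have [p ps tp] := near_node n tab.
  have pab := itv_partition_mem ab (s_part n) ps.
  have := d1_oscillation n i pab tab.
  have := ler_wpM2r C_ge0 (le_trans tp (mesh_le n)).
  have : H2_d1 (u_ n i) p ^+ 2 <= 1.
    by rewrite -(d1_node ps) (bigD1 i)//= lerDl sumr_ge0// => j _; exact: sqr_ge0.
  have split4 (v q r r' : R) : q ^+ 2 <= 1 -> r <= r' -> (v - q) ^+ 2 <= r ->
      v ^+ 2 <= 2 + 2 * r'.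
    by have := sqr_ge0 (v - 2 * q); lra.
  by rewrite -mulrA; exact: split4.
(* Within distance 2 rho of x the functions vary by at most eta / 2, since
   2 rho B <= (eta / 2)^2. *)
pose rho := (eta / 2) ^+ 2 / (2 * (B + 1)).
have rho0 : 0 < rho by rewrite divr_gt0 ?exprn_gt0 ?divr_gt0// mulr_gt0// ltr_wpDl.
pose y := Num.max a (x - rho); pose z := Num.min b (x + rho).
move: (xab); rewrite in_itv/= => /andP[ax xb].
have yz : y < z by rewrite gt_max !lt_min ab/=; apply/andP; split; [|apply/andP; split]; lra.
have : c * (z - y) <= 0; last by rewrite leNgt mulr_gt0 ?subr_gt0.
have eps0' : 2 * eps n * K @[n --> \oo] --> 0.
  rewrite -[X in _ --> X](mul0r K) -[X in X * K](mulr0 2).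
  by apply: cvgM; [apply: cvgM => //; exact: cvg_cst|exact: cvg_cst].
have near_x : \forall n \near \oo, forall i, `|H2_fun (u_ n i) x - H2_fun (u i) x| < eta / 2.
  apply: filter_forall => i; have eta2 : 0 < eta / 2 by rewrite divr_gt0.
  have := (@cvgrPdist_lt _ _ _ _ _ _ _).1 (weak_cvg_H2_fun (i := i) ab u_u xab) _ eta2.
  by move=> h; near=> n; rewrite distrC; near: n; exact: h.
refine (cvgr_to_ge eps0' _); near=> n.
apply: le_trans (penalty_bounded n).
apply: (le_Rintegral_interp1 ab (s_part n)) => //.
- by move=> t; exact: VD_ge0.
- exact: ltW.
- by rewrite le_max lexx.
- exact: ltW.
- by rewrite ge_min lexx.
move=> t tab yt tz; apply: VDc => i; rewrite !mxE.
have mrho : mesh a (s n) < rho by near: n; exact: (cvgr_lt 0 mesh0).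
have tx : `|t - x| <= 2 * rho.
  have : x - rho <= y by rewrite le_max lexx orbT.
  have : z <= x + rho by rewrite ge_min lexx orbT.
  by move=> ? ?; rewrite ler_norml; apply/andP; split; lra.
rewrite -(subrK (H2_fun (u_ n i) x) (H2_fun _ t)) -addrA.
rewrite (le_lt_trans (ler_normD _ _))// (splitr eta) ler_ltD//; last first.
  by move: i; near: n.
rewrite -ler_sqr ?nnegrE ?divr_ge0 ?(ltW eta0)// real_normK ?num_real//.
apply: (le_trans (osc n i t tab)); apply: (le_trans (ler_wpM2r B0 tx)).
have <- : rho * (2 * (B + 1)) = (eta / 2) ^+ 2.
  by rewrite /rho divfK// gt_eqF// mulr_gt0// ltr_wpDl.
by have := rho0; lra.
Unshelve. all: by end_near. Qed.

End LowerBound.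

(** * The liminf inequality *)

Section LiminfInequality.
Context {R : realType}.

(** The liminf is the supremum of the tail infima, so a value above it is undercut
    in each tail; this provides a subsequence of bounded energy. *)
Lemma limn_einf_frequently (u : (\bar R)^nat) (K : \bar R) :
  (limn_einf u < K)%E -> forall N, exists2 n, (N <= n)%N & (u n < K)%E.
Proof.
rewrite limn_einf_lim (cvg_lim _ (@cvg_einfs_sup _ u))// => uK N.
have /ereal_inf_lt[_ [n /= Nn <-] unK] : (einfs u N < K)%E.
  by apply: le_lt_trans uK; apply: ereal_sup_ubound; exists N.
by exists n.
Qed.

Lemma lee_real_bounds (x y : \bar R) :
  (forall K : R, (x < K%:E)%E -> (y <= K%:E)%E) -> (y <= x)%E.
Proof.
case: x => [r||] h; last 2 first.
- exact: leey.
- case: y h => [r||] h //; last by have := h 0 (ltNyr 0).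
  by have := h (r - 1) (ltNyr (r - 1)); rewrite lee_fin leNgt ltrBlDr ltrDl ltr01.
- by apply/lee_addgt0Pr => e e0; rewrite -EFinD; apply: h; rewrite lte_fin ltrDl.
Qed.

(** If the liminf is below K, then along a subsequence the functions are admissible
    and have energy below K, so the results on sequences of bounded energy
    apply. *)
Lemma liminf_inequality (a b : R) (ab : a < b) (m : nat) (G : 'I_m -> 'M[R]_3)
    (l : nat) (Lbc : {linear H2v a b -> 'cV[R]_l}) (lbc : 'cV[R]_l)
    (Lbc_bounded : bounded_op Lbc) (P : R -> seq R)
    (HP : forall h, 0 < h -> h <= b - a ->
            itv_partition a b (P h) /\ mesh a (P h) = h)
    (kappa : R) (kappa_gt0 : 0 < kappa) (h eps : nat -> R) :
  (forall n, 0 < h n) -> (forall n, 0 < eps n) ->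
  h @ \oo --> 0 -> eps @ \oo --> 0 ->
  forall (u_ : nat -> H2v a b) (u : H2v a b), weak_cvg u_ u ->
  (Ebend G Lbc lbc kappa u <=
   limn_einf (fun n => Eh G Lbc lbc kappa (P (h n)) (eps n) (u_ n)))%E.
Proof.
move=> h0 eps0 ch ceps u_ u uu; apply: lee_real_bounds => K /limn_einf_frequently freq.
(* P h is known to be a partition of mesh h for h <= b - a. *)
have [N0 _ hN0] : \forall n \near \oo, h n <= b - a.
  by apply: (cvgr_le 0 ch); rewrite subr_gt0.
have /choice[phi phiP] N : exists n, [/\ (N <= n)%N, h n <= b - a &
    (Eh G Lbc lbc kappa (P (h n)) (eps n) (u_ n) < K%:E)%E].
  have [n Nn EK] := freq (maxn N N0); exists n; split => //.
  - exact: leq_trans (leq_maxl _ _) Nn.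
  - by apply: hN0 => /=; exact: leq_trans (leq_maxr _ _) Nn.
have cphi (T : topologicalType) (f : nat -> T) (x : T) :
    f @ \oo --> x -> f (phi n) @[n --> \oo] --> x.
  move=> fx A /fx [M _ MA]; exists M => // n /= Mn; apply: MA => /=.
  by apply: leq_trans Mn _; have [] := phiP n.
have part n : itv_partition a b (P (h (phi n))) /\ mesh a (P (h (phi n))) = h (phi n).
  by have [_ hle _] := phiP n; exact: HP.
have adm n : admissible_h Lbc lbc (P (h (phi n))) (u_ (phi n)).
  by have [_ _] := phiP n; rewrite /Eh; case: asboolP.
have EK n : kappa / 2 *
    \sum_i \int[@lebesgue_measure R]_(t in `[a, b]) (H2_d2 (u_ (phi n) i) t ^+ 2) +
    (2 * eps (phi n))^-1 * \int[@lebesgue_measure R]_(x in `[a, b])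
      (interp1 (fun t => VD G (vfun (u_ (phi n)) t)) a (P (h (phi n))) x) <= K.
  have [_ _] := phiP n; rewrite /Eh; case: asboolP => // _.
  by rewrite lte_fin -bendE => /ltW.
have mesh0 : mesh a (P (h (phi n))) @[n --> \oo] --> 0.
  under eq_fun do rewrite (part _).2; exact: (cphi _ _ _ ch).
have uu' : weak_cvg (u_ \o phi) u by move=> F bF; exact: (cphi _ _ _ (uu F bF)).
have parts n := (part n).1.
have epsphi n := eps0 (phi n).
have cepsphi := cphi _ _ _ ceps.
rewrite /Ebend; case: asboolP => [_|]; last first.
  case; split; last exact: (limit_confined ab kappa_gt0 parts mesh0 epsphi cepsphi uu' adm EK).
  split; last exact: (limit_boundary Lbc_bounded uu' adm).
  apply: aeW => x xab.
  exact: (limit_unit ab kappa_gt0 parts mesh0 epsphi uu' adm EK).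
rewrite lee_fin bendE.
have := limit_bend ab kappa_gt0 parts epsphi uu' EK.
by rewrite mulrAC ler_pdivlMr//; lra.
Qed.

End LiminfInequality.

(** * Elementary members of H^2 *)

Section ElementaryH2.
Context {R : realType} (a b : R) (ab : a < b).
Local Notation mu := (@lebesgue_measure R).
Implicit Types (f g : R -> R) (c t x : R).

Lemma L2_of_sqr_integrable f : measurable_fun `[a, b] f ->
  mu.-integrable `[a, b] (EFin \o (fun t => f t ^+ 2)) -> L2 a b f.
Proof.
move=> mf f2; rewrite /L2.
have mab : measurable (`[a, b] : set (measurableTypeR R)) by exact: measurable_itv.
have mr : measurable_fun setT (f \_ `[a, b]) by apply/(measurable_restrictT _ _).1.
rewrite inE; apply/andP; split; first by rewrite inE.
rewrite inE /= /finite_norm unlock /Lnorm; apply: poweR_lty => /=.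
have /integrableP[_] := (integrable_mkcond _ mab).1 f2; apply: le_lt_trans.
rewrite le_eqVlt; apply/orP; left; apply/eqP; apply: eq_integral => t _.
rewrite /patch; case: ifP => _ /=.
  by rewrite powR_mulrn// normrX.
by rewrite normr0 powR0.
Qed.

Lemma L2_continuous f : {within `[a, b], continuous f} -> L2 a b f.
Proof.
move=> cf; apply: L2_of_sqr_integrable.
  by apply: subspace_continuous_measurable_fun => //; exact: measurable_itv.
by apply: (@integrableM_continuous _ f f) => //; exact: integrable_continuous.
Qed.

(** Integration by parts; the boundary terms vanish with the test function. *)
Lemma weak_derivative_is_derive f g : (forall t, is_derive t 1 f (g t)) ->
  continuous g -> weak_derivative a b f g.
Proof.
move=> fg cg phi tphi; have [cphi cphi'] := test_function_continuous tphi.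
have [sphi [c [d [ac db phi0]]]] := tphi.
have dphi t : is_derive t 1 phi (derive1 phi t).
  by split; [exact: (sphi 0%N)|rewrite derive1E].
have cf : continuous f.
  by move=> t; apply: differentiable_continuous; apply/derivable1_diffP; have [] := fg t.
have i1 : mu.-integrable `[a, b] (EFin \o (fun t => f t * derive1 phi t)).
  by apply: integrableM_continuous; [apply: integrable_continuous|];
    exact: continuous_subspaceT.
have i2 : mu.-integrable `[a, b] (EFin \o (fun t => g t * phi t)).
  by apply: integrableM_continuous; [apply: integrable_continuous|];
    exact: continuous_subspaceT.
have mab : measurable (`[a, b] : set (measurableTypeR R)) by exact: measurable_itv.
apply/eqP; rewrite -addr_eq0 -(RintegralD mab i1 i2); apply/eqP.
have dF t : is_derive t 1 (f * phi) (f t * derive1 phi t + g t * phi t).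
  by apply: is_derive_eq; rewrite -[_ *: g t]/(_ * _) [phi t * _]mulrC.
have cF : continuous (fun t => f t * derive1 phi t + g t * phi t).
  by move=> t; apply: cvgD; apply: cvgM; [exact: cf|exact: cphi'|exact: cg|exact: cphi].
rewrite (Rintegral_is_derive ab dF cF) !fctE (phi0 a) ?(phi0 b) ?mulr0 ?subrr//.
- by rewrite in_itv/= negb_and -!ltNge db orbT.
- by rewrite in_itv/= negb_and -!ltNge ac.
Qed.

(** The truncated powers (t - c)_+^k with k = 2, 3 are of class C^1 on the whole
    line and vanish before c, so that splines can be built from left to right as
    linear combinations in H^2, without gluing pieces. *)
Definition pos_part c t : R := if c < t then t - c else 0.

Lemma continuous_pos_part c : continuous (pos_part c).
Proof.
have -> : pos_part c = fun t => 2^-1 * (`|t - c| + (t - c)).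
  apply/funext => t; rewrite /pos_part; have [ct|tc] := ltP c t.
    by rewrite gtr0_norm ?subr_gt0//; lra.
  by rewrite ler0_norm ?subr_le0//; lra.
move=> t; apply: cvgM; first exact: cvg_cst.
have ctc : t - c @[t --> t] --> t - c by apply: cvgB; [exact: cvg_id|exact: cvg_cst].
by apply: cvgD => //; exact: cvg_norm.
Qed.

Lemma is_derive_pos_part2 c t :
  is_derive t 1 (fun t => pos_part c t ^+ 2) (2 * pos_part c t).
Proof.
have [tc|ct|->] := ltgtP t c.
- rewrite /pos_part ltNge (ltW tc)/= mulr0; apply: (@near_eq_is_derive _ _ _ (cst 0)).
  near=> z; rewrite ifF ?expr0n//; apply/negbTE; rewrite -leNgt ltW//.
  by near: z; exact: lt_nbhsl.
- rewrite /pos_part ct; apply: (@near_eq_is_derive _ _ _ ((id - cst c) ^+ 2)).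
    by near=> z; rewrite ifT//; near: z; exact: lt_nbhsr.
  by apply: is_derive_eq; rewrite subr0 /= expr1 -[LHS]/(_ * _) mulr1.
- rewrite /pos_part ltxx mulr0; apply: (@is_derive_quadratic _ _ _ 1) => z.
  rewrite mul1r; case: ifP => _; last by rewrite expr0n normr0 sqr_ge0.
  by rewrite ger0_norm ?sqr_ge0.
Unshelve. all: by end_near. Qed.

Lemma is_derive_pos_part3 c t :
  is_derive t 1 (fun t => pos_part c t ^+ 3) (3 * pos_part c t ^+ 2).
Proof.
have -> : (fun t => pos_part c t ^+ 3) =
    (fun t => pos_part c t ^+ 2) * (id - cst c).
  apply/funext => z; rewrite !fctE /pos_part; case: ifP => _ /=.
    by rewrite exprSr.
  by rewrite !expr0n mul0r.
have := is_derive_pos_part2 c t => d2.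
apply: is_derive_eq; rewrite subr0 -[_ *: 1]/(_ * 1) -[_ *: (2 * _)]/(_ * _) !fctE.
by rewrite /pos_part; case: ifP => _ /=; ring.
Qed.

Lemma Rintegral_right g c : continuous g -> a <= c -> c <= b ->
  \int[mu]_(t in `[a, b]) (if c < t then g t else 0) = \int[mu]_(t in `[c, b]) g t.
Proof.
move=> cg ac cb.
have gi x y : mu.-integrable `[x, y] (EFin \o g).
  by apply: integrable_continuous; exact: continuous_subspaceT.
rewrite -[RHS]Rintegral_itv_obnd_cbnd; last first.
  have gicb := gi c b; apply: integrableS gicb => //.
  by apply: subset_itv; rewrite bnd_simp.
have -> : [set` `]c, b]] = [set` `[a, b]] `&` [set` `]c, b]] :> set R.
  apply/seteqP; split => t /=; rewrite !in_itv/=; last by case.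
  by move=> /andP[ct tb]; rewrite ct tb (ltW (le_lt_trans ac ct)).
rewrite [RHS]Rintegral_mkcondr; apply: eq_Rintegral => t; rewrite inE/= in_itv/=.
by move=> /andP[at_ tb]; rewrite /patch mem_setE in_itv/= tb andbT.
Qed.

(** Integration by parts on [c, b]: the boundary term at c vanishes because of the
    factor t - c, the one at b because of the test function. *)
Lemma weak_derivative_pos_part c : a <= c -> c <= b ->
  weak_derivative a b (pos_part c) (fun t => if c < t then 1 else 0).
Proof.
move=> ac cb phi tphi; have [cphi cphi'] := test_function_continuous tphi.
have [sphi [c' [d [ac' db phi0]]]] := tphi.
have dphi t : is_derive t 1 phi (derive1 phi t).
  by split; [exact: (sphi 0%N)|rewrite derive1E].
have cl : continuous (fun t => t - c).
  by move=> t; apply: cvgB; [exact: cvg_id|exact: cvg_cst].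
have cg : continuous (fun t => (t - c) * derive1 phi t).
  by move=> t; apply: cvgM; [exact: cl|exact: cphi'].
under eq_Rintegral do rewrite /pos_part (fun_if (fun z => z * _)) mul0r.
under [in RHS]eq_Rintegral do rewrite (fun_if (fun z => z * _)) mul0r mul1r.
rewrite !Rintegral_right//.
move: cb; rewrite le_eqVlt => /predU1P[->|cb].
  by rewrite set_itv1 !Rintegral_set1 oppr0.
have mcb : measurable (`[c, b] : set (measurableTypeR R)) by exact: measurable_itv.
have i1 : mu.-integrable `[c, b] (EFin \o (fun t => (t - c) * derive1 phi t)).
  by apply: integrable_continuous; exact: continuous_subspaceT.
have i2 : mu.-integrable `[c, b] (EFin \o phi).
  by apply: integrable_continuous; exact: continuous_subspaceT.
apply/eqP; rewrite -addr_eq0 -(RintegralD mcb i1 i2); apply/eqP.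
have dF t : is_derive t 1 ((id - cst c) * phi) ((t - c) * derive1 phi t + phi t).
  apply: is_derive_eq; rewrite subr0 -[_ *: 1]/(_ * _) mulr1.
  by rewrite -[_ *: _]/(_ * _).
have cF : continuous (fun t => (t - c) * derive1 phi t + phi t).
  by move=> t; apply: cvgD; [exact: cg|exact: cphi].
rewrite (Rintegral_is_derive cb dF cF) !fctE subrr mul0r (phi0 b) ?mulr0 ?subrr//.
by rewrite in_itv/= negb_and -!ltNge db orbT.
Qed.

Lemma H2_exists f f' f'' : (forall t, is_derive t 1 f (f' t)) -> continuous f' ->
  L2 a b f'' -> weak_derivative a b f' f'' ->
  exists v : H2 a b, [/\ H2_fun v = f, H2_d1 v = f' & H2_d2 v = f''].
Proof.
move=> df cf' L2f'' wf'.
have cf : continuous f.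
  by move=> t; apply: differentiable_continuous; apply/derivable1_diffP; have [] := df t.
have jet : H2_pred a b (f : R -> R^o, f' : R -> R^o, f'' : R -> R^o).
  apply/asboolP; split; split => //.
  - by apply: L2_continuous; exact: continuous_subspaceT.
  - by apply: L2_continuous; exact: continuous_subspaceT.
  - exact: weak_derivative_is_derive.
  - exact: continuous_subspaceT.
  - exact: continuous_subspaceT.
by exists (mkH2 jet).
Qed.

Lemma H2_smooth_exists f f' f'' : (forall t, is_derive t 1 f (f' t)) ->
  (forall t, is_derive t 1 f' (f'' t)) -> continuous f'' ->
  exists v : H2 a b, [/\ H2_fun v = f, H2_d1 v = f' & H2_d2 v = f''].
Proof.
move=> df df' cf''; apply: H2_exists => //.
- by move=> t; apply: differentiable_continuous; apply/derivable1_diffP; have [] := df' t.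
- by apply: L2_continuous; exact: continuous_subspaceT.
- exact: weak_derivative_is_derive.
Qed.

Lemma H2_affine p q : exists v : H2 a b, [/\ H2_fun v = (fun t => p + q * (t - a)),
  H2_d1 v = cst q & H2_d2 v = cst 0].
Proof.
apply: H2_smooth_exists; last exact: cst_continuous.
move=> t; have -> : (fun t => p + q * (t - a)) = cst p + q \*: (id - cst a) by [].
by apply: is_derive_eq; rewrite add0r subr0 -[LHS]/(q * 1) mulr1.
Qed.

Lemma L2_step k c : L2 a b (fun t => if c < t then k else 0).
Proof.
have mf : measurable_fun setT (fun t : R => if c < t then k else 0).
  apply: measurable_fun_ifT; try exact: measurable_cst.
  by apply: measurable_fun_ltr => //; exact: measurable_cst.
apply: L2_of_sqr_integrable; first exact: measurable_funTS.
apply: measurable_bounded_integrable.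
- exact: measurable_itv.
- by rewrite /= lebesgue_measure_itv/= lte_fin ab ltry.
- by apply: measurable_funTS; exact: measurable_funX.
exists (k ^+ 2); split; first exact: num_real.
move=> M kM t _ /=; apply/ltW/(le_lt_trans _ kM).
by rewrite ger0_norm ?sqr_ge0//; case: ifP => // _; rewrite expr0n sqr_ge0.
Qed.

Lemma H2_pos_part2 c : a <= c -> c <= b -> exists v : H2 a b,
  [/\ H2_fun v = (fun t => pos_part c t ^+ 2), H2_d1 v = (fun t => 2 * pos_part c t) &
      H2_d2 v = (fun t => if c < t then 2 else 0)].
Proof.
move=> ac cb; apply: H2_exists.
- exact: is_derive_pos_part2.
- move=> t; apply: cvgM; [exact: cvg_cst|exact: continuous_pos_part].
- exact: L2_step.
have cp : {within `[a, b], continuous (pos_part c)}.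
  exact: continuous_subspaceT (@continuous_pos_part c).
have := weak_derivative_lin 2 (L2_continuous cp) (L2_step 1 c) (L2_0 a b) (L2_0 a b)
  (weak_derivative_pos_part ac cb) (@weak_derivative_0 R a b).
rewrite !addr0 (_ : 2 *: (fun t => if c < t then 1 else 0) =
  (fun t => if c < t then 2 else 0))//.
by apply/funext => t; rewrite -[LHS]/(2 * _); case: ifP => _; rewrite ?mulr1 ?mulr0.
Qed.

Lemma H2_pos_part3 c : a <= c -> c <= b -> exists v : H2 a b,
  [/\ H2_fun v = (fun t => pos_part c t ^+ 3), H2_d1 v = (fun t => 3 * pos_part c t ^+ 2) &
      H2_d2 v = (fun t => 6 * pos_part c t)].
Proof.
move=> ac cb; apply: H2_smooth_exists.
- exact: is_derive_pos_part3.
- move=> t; have -> : (fun t => 3 * pos_part c t ^+ 2) =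
      3 \*: (fun t => pos_part c t ^+ 2) by [].
  have := is_derive_pos_part2 c t => d2.
  by apply: is_derive_eq; rewrite -[LHS]/(_ * _); ring.
- by move=> t; apply: cvgM; [exact: cvg_cst|exact: continuous_pos_part].
Qed.

End ElementaryH2.

(** * Cubic Hermite splines *)

Section Spline.
Context {R : realType} (a b : R) (ab : a < b).
Implicit Types (v w : H2 a b) (p q x : R).

(** Differentiability on the whole line is convenient because it is preserved by
    linear combinations and holds for all the truncated powers used. *)
Definition C1_H2 v := forall x : R, is_derive x 1 (H2_fun v : R -> R) (H2_d1 v x).

(** The second derivative is prescribed on ]p, q] only, since the second
    derivative of a truncated square jumps at its knot and takes the left limit
    there. *)
Definition cubic_on v p q (gamma delta : R) :=
  [/\ forall x, p <= x -> x <= q -> H2_fun v x =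
        H2_fun v p + H2_d1 v p * (x - p) + gamma * (x - p) ^+ 2 + delta * (x - p) ^+ 3,
      forall x, p <= x -> x <= q -> H2_d1 v x =
        H2_d1 v p + 2 * gamma * (x - p) + 3 * delta * (x - p) ^+ 2 &
      forall x, p < x -> x <= q -> H2_d2 v x = 2 * gamma + 6 * delta * (x - p)].

Definition agree_before v w p := forall x, x <= p ->
  [/\ H2_fun w x = H2_fun v x, H2_d1 w x = H2_d1 v x & H2_d2 w x = H2_d2 v x].

Lemma agree_cubic v w p q gamma delta : p <= q -> agree_before v w q ->
  cubic_on v p q gamma delta -> cubic_on w p q gamma delta.
Proof.
move=> pq vw [v0 v1 v2]; have [wp wp' _] := vw p pq.
split=> x px xq; rewrite ?wp ?wp'.
- by have [-> _ _] := vw x xq; exact: v0.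
- by have [_ -> _] := vw x xq; exact: v1.
- by have [_ _ ->] := vw x xq; exact: v2.
Qed.

(** Taylor expansion of the cubic at q instead of p. *)
Lemma cubic_shift v p q r gamma delta : p <= q -> cubic_on v p r gamma delta -> q <= r ->
  cubic_on v q r (gamma + 3 * delta * (q - p)) delta.
Proof.
move=> pq [v0 v1 v2] qr; split=> x qx xr.
- rewrite (v0 x) ?(le_trans pq)// (v0 q)// (v1 q)//; ring.
- rewrite (v1 x) ?(le_trans pq)// (v1 q)//; ring.
- by rewrite v2 ?(le_lt_trans pq)//; ring.
Qed.

(** The two truncated powers at p vanish up to p, and their values and slopes at q
    are independent, so the Hermite data at q can be corrected. *)
Lemma spline_step v p q gamma delta y0 y1 : a <= p -> p < q -> q <= b ->
  C1_H2 v -> cubic_on v p b gamma delta ->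
  exists w gamma' delta', [/\ C1_H2 w, agree_before v w p,
    cubic_on w p b gamma' delta', H2_fun w q = y0 & H2_d1 w q = y1].
Proof.
move=> ap pq qb Cv [v0 v1 v2]; have pb := le_trans (ltW pq) qb.
have [B2 [B20 B21 B22]] := H2_pos_part2 ab ap pb.
have [B3 [B30 B31 B32]] := H2_pos_part3 ab ap pb.
set k := q - p; have k0 : 0 < k by rewrite subr_gt0.
pose e0 := y0 - H2_fun v q; pose e1 := y1 - H2_d1 v q.
(* g and d solve g k^2 + d k^3 = e0 and 2 g k + 3 d k^2 = e1. *)
pose g := (3 * e0 - e1 * k) / k ^+ 2; pose d := (e1 * k - 2 * e0) / k ^+ 3.
pose w := g *: B2 + (d *: B3 + v).
have wE x : H2_fun w x = g * pos_part p x ^+ 2 + (d * pos_part p x ^+ 3 + H2_fun v x).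
  by rewrite !H2_funE B20 B30.
have w'E x : H2_d1 w x =
    g * (2 * pos_part p x) + (d * (3 * pos_part p x ^+ 2) + H2_d1 v x).
  by rewrite !H2_d1E B21 B31.
have w''E x : H2_d2 w x =
    g * (if p < x then 2 else 0) + (d * (6 * pos_part p x) + H2_d2 v x).
  by rewrite !H2_d2E B22 B32.
have pp x : p <= x -> pos_part p x = x - p.
  by rewrite /pos_part le_eqVlt => /predU1P[<-|->//]; rewrite ltxx subrr.
have pp0 x : x <= p -> pos_part p x = 0.
  by rewrite /pos_part => xp; rewrite ltNge xp.
have knz : k != 0 by rewrite gt_eqF.
exists w, (gamma + g), (delta + d); split.
- move=> x; have -> : (H2_fun w : R -> R) = (g \*: H2_fun B2 + (d \*: H2_fun B3 + H2_fun v)).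
    by apply/funext => z; rewrite !H2_funE.
  have dB2 : is_derive x 1 (H2_fun B2 : R -> R) (H2_d1 B2 x).
    by rewrite B20 B21; exact: is_derive_pos_part2.
  have dB3 : is_derive x 1 (H2_fun B3 : R -> R) (H2_d1 B3 x).
    by rewrite B30 B31; exact: is_derive_pos_part3.
  have dv := Cv x.
  exact: (is_deriveD (is_deriveZ g dB2) (is_deriveD (is_deriveZ d dB3) dv)).
- move=> x xp; rewrite wE w'E w''E pp0// ltNge xp/=; split; ring.
- have wp : H2_fun w p = H2_fun v p by rewrite wE pp0//; ring.
  have wp' : H2_d1 w p = H2_d1 v p by rewrite w'E pp0//; ring.
  split=> x px xb.
  + by rewrite wE wp wp' pp// v0//; ring.
  + by rewrite w'E wp' pp// v1//; ring.
  + by rewrite w''E px pp ?(ltW px)// v2//; ring.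
- by rewrite wE pp ?(ltW pq)// -/k /g /d /e0; field.
- by rewrite w'E pp ?(ltW pq)// -/k /g /d /e1; field.
Qed.

Lemma spline_exists (U D : R -> R) s p v gamma delta : a <= p -> path <%R p s ->
  last p s = b -> C1_H2 v -> cubic_on v p b gamma delta ->
  H2_fun v p = U p -> H2_d1 v p = D p ->
  exists w, [/\ C1_H2 w, agree_before v w p,
    forall x, x \in p :: s -> H2_fun w x = U x /\ H2_d1 w x = D x &
    forall i, (i < size s)%N ->
      exists gamma delta, cubic_on w (p :: s)`_i s`_i gamma delta].
Proof.
elim: s p v gamma delta => [|q s IH] p v gamma delta ap /=.
  move=> _ _ Cv _ vp vp'; exists v; split => // x.
  by rewrite inE => /eqP ->.
move=> /andP[pq ps] lb Cv cv vp vp'.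
have qb : q <= b by rewrite -lb; exact: path_le_last.
have [v1 [g [d [Cv1 vv1 cv1 v1q v1q']]]] := spline_step (U q) (D q) ap pq qb Cv cv.
have aq := le_trans ap (ltW pq).
have [w [Cw v1w wn wc]] := IH q v1 _ _ aq ps lb Cv1 (cubic_shift (ltW pq) cv1 qb) v1q v1q'.
have vw : agree_before v w p.
  move=> x xp; have [-> -> ->] := v1w x (le_trans xp (ltW pq)); exact: vv1.
exists w; split => //.
  move=> x; rewrite inE => /predU1P[->|xs]; last exact: wn.
  by have [-> -> _] := vw p (lexx p).
move=> [_|i is_]; last exact: wc.
exists g, d; apply: (agree_cubic (ltW pq) v1w).
have [c0 c1 c2] := cv1.
by split=> x px xq; [apply: c0|apply: c1|apply: c2] => //; exact: le_trans qb.
Qed.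

Lemma hermite_spline (U D : R -> R) s : itv_partition a b s ->
  exists w, [/\ C1_H2 w,
    forall x, x \in a :: s -> H2_fun w x = U x /\ H2_d1 w x = D x &
    forall i, (i < size s)%N ->
      exists gamma delta, cubic_on w (a :: s)`_i s`_i gamma delta].
Proof.
move=> [ps /eqP lE].
(* The construction starts from the tangent at a, a cubic with vanishing higher
   coefficients. *)
have [v [v0 v1 v2]] := H2_affine ab (U a) (D a).
have Cv : C1_H2 v.
  move=> x; rewrite v0 v1.
  have -> : (fun t => U a + D a * (t - a)) = cst (U a) + D a \*: (id - cst a) by [].
  by apply: is_derive_eq; rewrite add0r subr0 -[LHS]/(D a * 1) mulr1.
have cv : cubic_on v a b 0 0 by split=> x _ _; rewrite ?v0 ?v1 ?v2 /=; ring.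
have va : H2_fun v a = U a by rewrite v0; ring.
have va' : H2_d1 v a = D a by rewrite v1.
have [w [Cw _ wn wc]] := spline_exists (lexx a) ps lE Cv cv va va'.
by exists w.
Qed.

End Spline.

(** * The error of Hermite interpolation *)

Section H3Regularity.
Context {R : realType} (a b : R) (ab : a < b).
Local Notation mu := (@lebesgue_measure R).
Local Notation energy g := (\int[mu]_(t in `[a, b]) (g t ^+ 2)).
Implicit Types (f g : R -> R) (x y t : R).

(** Almost everywhere properties hold at some point of each nonempty open interval,
    since such an interval is not null. *)
Lemma ae_exists_itv (Q : R -> Prop) y z : {ae mu, forall x, Q x} -> y < z ->
  exists x, y < x < z /\ Q x.
Proof.
move=> [N [mN N0 QN]] yz; apply: contrapT => nQ.
have sub : `]y, z[ `<=` N.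
  move=> x /=; rewrite in_itv/= => xyz; apply: QN => /= Qx; apply: nQ.
  by exists x.
have : (mu `]y, z[ <= mu N)%E by apply: le_measure => //; rewrite inE//; exact: measurable_itv.
rewrite N0 lebesgue_measure_itv/= lte_fin yz -EFinB lee_fin.
by rewrite leNgt subr_gt0 yz.
Qed.

Lemma ae_neq c : {ae mu, forall x : R, x != c}.
Proof.
exists [set c]; split; [exact: measurable_set1|exact: lebesgue_measure_set1|].
by move=> x /= /negP; rewrite negbK => /eqP.
Qed.

Lemma ae_continuous_cst f c : {within `[a, b], continuous f} ->
  {ae mu, forall x, x \in `[a, b] -> f x = c} -> forall x, x \in `[a, b] -> f x = c.
Proof.
move=> cf fc x xab; apply/eqP; rewrite -subr_eq0; apply: contrapT => /negP fxc.
have e0 : 0 < `|f x - c| by rewrite normr_gt0.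
move/subspace_continuousP : cf => /(_ x xab) /cvgrPdist_lt /(_ _ e0).
move=> /nbhs_ballP[d /= d0 df].
move: (xab); rewrite in_itv/= => /andP[ax xb].
have yz : Num.max a (x - d) < Num.min b (x + d).
  by rewrite gt_max !lt_min ab/=; apply/andP; split; [|apply/andP; split]; lra.
have [t [/andP[yt tz] ft]] := ae_exists_itv fc yz.
move: yt tz; rewrite gt_max lt_min => /andP[at_ xt] /andP[tb tx].
have tab : t \in `[a, b] by rewrite in_itv/= !ltW.
have : `|f x - f t| < `|f x - c|.
  apply: df => //; rewrite -ball_normE /ball_/= ltr_norml; apply/andP; split; lra.
by rewrite ft// ltxx.
Qed.

(** By the fundamental theorem of calculus at Lebesgue points, u'' agrees almost
    everywhere with a constant plus the primitive of the third derivative.  This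
    continuous representative replaces u''; its Hoelder bound is the only
    information about third derivatives that the error estimate uses. *)
Lemma H3_regular (v : H2 a b) : in_H3 v -> exists w : H2 a b, exists K,
  [/\ H2_fun w = H2_fun v, H2_d1 w = H2_d1 v, energy (H2_d2 w) = energy (H2_d2 v), 0 <= K &
    forall x y, x \in `[a, b] -> y \in `[a, b] ->
      (H2_d2 w y - H2_d2 w x) ^+ 2 <= K * `|y - x|].
Proof.
move=> [g [Lg wg]]; have [L0 L1 L2] := H2_L2 v.
have [w0 w1] := H2_weak_derivative v; have [c0 c1] := H2_continuous v.
have mab : measurable (`[a, b] : set (measurableTypeR R)) by exact: measurable_itv.
set f := H2_d2 v in L2 wg w1 *.
have fi := L2_integrable L2; have gi := L2_integrable Lg.
have leb := lebesgue_differentiation (integrable_locally_restrict mab fi).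
have [y0 [/andP[ay0 y0b] leby0]] := ae_exists_itv leb ab.
pose I x := \int[mu]_(t in `[a, x]) g t.
pose F x := f y0 - I y0 + I x.
have cI : {within `[a, b], continuous I}.
  exact: parameterized_integral_continuous (ltW ab) gi.
have cF : {within `[a, b], continuous F}.
  move: cI => /subspace_continuousP cI; apply/subspace_continuousP => z zab.
  by apply: cvgD; [exact: cvg_cst|exact: cI].
have fF x : lebesgue_pt (f \_ `[a, b]) x -> a < x -> x < b -> f x = F x.
  move=> lebx ax xb; rewrite /F /I; have [xy|yx|->] := ltgtP x y0; last by rewrite subrK.
  - have := weak_FTC fi gi wg ax xy y0b lebx leby0.
    by rewrite -(RintegralB_itv gi (ltW ax) (ltW xy) (ltW y0b)); lra.
  - have := weak_FTC fi gi wg ay0 yx xb leby0 lebx.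
    by rewrite -(RintegralB_itv gi (ltW ay0) (ltW yx) (ltW xb)); lra.
have aeF : {ae mu, forall x, x \in `[a, b] -> f x = F x}.
  have FF := ae_filter_ringOfSetsType mu.
  apply: (@filterS3 _ (almost_everywhere mu) FF _ _ _ _ _
    leb (ae_neq a) (ae_neq b)) => x lebx xa xb.
  rewrite in_itv/= => /andP[ax xb']; apply: fF => //.
    by rewrite lt_neqAle ax andbT eq_sym.
  by rewrite lt_neqAle xb' andbT.
have LF : Defs.L2 a b F by exact: L2_continuous.
have eq_int (k : R -> R -> R) : measurable_fun `[a, b] (fun t => k t (f t)) ->
    measurable_fun `[a, b] (fun t => k t (F t)) ->
    \int[mu]_(t in `[a, b]) k t (F t) = \int[mu]_(t in `[a, b]) k t (f t).
  move=> m1 m2; rewrite /Rintegral; congr fine; apply: ae_eq_integral => //.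
  - exact/measurable_EFinP.
  - exact/measurable_EFinP.
  have FF := ae_filter_ringOfSetsType mu.
  by apply: (@filterS _ (almost_everywhere mu) FF _ _ _ aeF) => x fx xab; rewrite fx.
have wF : weak_derivative a b (H2_d1 v) F.
  move=> phi tphi; rewrite w1//; congr (- _); symmetry.
  have [cphi _] := test_function_continuous tphi.
  have mphi : measurable_fun `[a, b] phi.
    by apply: measurable_funTS; exact: continuous_measurable_fun.
  apply: (eq_int (fun t z => z * phi t)); apply: measurable_funM => //; exact: L2_measurable.
have jet : H2_pred a b (H2_fun v : R -> R^o, H2_d1 v : R -> R^o, F : R -> R^o).
  by apply/asboolP; split.
exists (mkH2 jet), (energy g); split => //.
- by apply: (eq_int (fun=> (fun z => z ^+ 2))); apply: measurable_funX; exact: L2_measurable.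
- exact: energy_ge0.
move=> x y xab yab.
have -> : H2_d2 (mkH2 jet) y - H2_d2 (mkH2 jet) x = I y - I x.
  by rewrite -[H2_d2 (mkH2 jet) y]/(F y) -[H2_d2 (mkH2 jet) x]/(F x) /F; ring.
wlog xy : x y xab yab / x <= y => [h|].
  have [xy|/ltW yx] := leP x y; first exact: h.
  by rewrite -sqrrN opprB distrC h.
move: xab yab; rewrite !in_itv/= => /andP[ax xb] /andP[ay yb].
rewrite /I (RintegralB_itv gi)// ger0_norm ?subr_ge0// mulrC.
exact: L2_Rintegral_itv.
Qed.

End H3Regularity.

Section HermiteError.
Context {R : realType} (a b : R) (ab : a < b).
Local Notation mu := (@lebesgue_measure R).
Local Notation energy g := (\int[mu]_(t in `[a, b]) (g t ^+ 2)).
Implicit Types (f g : R -> R) (x y t p q : R).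

Lemma Rintegral_affine p q (A B : R) : p <= q ->
  \int[mu]_(t in `[p, q]) (A + B * (t - p)) = A * (q - p) + B * (q - p) ^+ 2 / 2.
Proof.
rewrite le_eqVlt => /predU1P[->|pq].
  by rewrite set_itv1 Rintegral_set1 subrr; ring.
pose F t := A * (t - p) + B / 2 * (t - p) ^+ 2.
have dF t : is_derive t 1 F (A + B * (t - p)).
  have -> : F = A \*: (id - cst p) + (B / 2) \*: ((id - cst p) ^+ 2).
    by apply/funext => z; rewrite !fctE.
  apply: is_derive_eq; rewrite subr0 /= !fctE /= -[A *: 1]/(A * 1).
  by rewrite -[_ *: (_ *: 1)]/(_ * (_ * 1)); field.
have cF : continuous (fun t => A + B * (t - p)).
  move=> t; apply: cvgD; first exact: cvg_cst.
  apply: cvgM; first exact: cvg_cst.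
  by apply: cvgB; [exact: cvg_id|exact: cvg_cst].
by rewrite (Rintegral_is_derive pq dF cF) /F subrr; field.
Qed.

Lemma Rintegral_affine_bounds f p q (A B A' B' : R) : p <= q ->
  mu.-integrable `[p, q] (EFin \o f) ->
  (forall t, p <= t -> t <= q -> A + B * (t - p) <= f t <= A' + B' * (t - p)) ->
  A * (q - p) + B * (q - p) ^+ 2 / 2 <= \int[mu]_(t in `[p, q]) f t <=
  A' * (q - p) + B' * (q - p) ^+ 2 / 2.
Proof.
move=> pq fi fb; rewrite -!(Rintegral_affine _ _ pq).
have ci (A0 B0 : R) : mu.-integrable `[p, q] (EFin \o (fun t => A0 + B0 * (t - p))).
  apply: integrable_continuous; apply: continuous_subspaceT => t.
  apply: cvgD; first exact: cvg_cst.
  apply: cvgM; first exact: cvg_cst.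
  by apply: cvgB; [exact: cvg_id|exact: cvg_cst].
have mpq : measurable (`[p, q] : set (measurableTypeR R)) by exact: measurable_itv.
apply/andP; split; apply: le_Rintegral => // t /=; rewrite in_itv/= => /andP[pt tq].
- by have /andP[] := fb t pt tq.
- by have /andP[] := fb t pt tq.
Qed.

(** Pure algebra of the Hermite cubic on a cell of length k.  With
    x = 2 gamma - c and y = 6 delta k, the value and slope conditions bound
    x + y/3 and x + y/2 by om, so that x and x + y, the extreme values of the
    second derivative minus c, are bounded by 7 om. *)
Lemma hermite_cubic_bound (gamma delta c k th om wt zp0 zp1 : R) :
  0 < k -> 0 <= om -> 0 < th -> th <= 1 -> c - om <= wt <= c + om ->
  zp1 * k + (c - om) * k ^+ 2 / 2 <=
    zp0 + zp1 * k + gamma * k ^+ 2 + delta * k ^+ 3 - zp0 <=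
    zp1 * k + (c + om) * k ^+ 2 / 2 ->
  zp1 + (c - om) * k <= zp1 + 2 * gamma * k + 3 * delta * k ^+ 2 <=
    zp1 + (c + om) * k ->
  (2 * gamma + 6 * delta * (k * th) - wt) ^+ 2 <= 64 * om ^+ 2.
Proof.
move=> k0 om0 th0 th1 hw hE hF.
have k2 : 0 < k ^+ 2 by rewrite exprn_gt0.
have [E1 E2] : - om <= 2 * gamma - c + 2 * (delta * k) /\
    2 * gamma - c + 2 * (delta * k) <= om.
  by move/andP: hE => [h1 h2]; split; rewrite -(ler_pM2r k2); clear -h1 h2; lra.
have [F1 F2] : - om <= 2 * gamma - c + 3 * (delta * k) /\
    2 * gamma - c + 3 * (delta * k) <= om.
  by move/andP: hF => [h1 h2]; split; rewrite -(ler_pM2r k0); clear -h1 h2; lra.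
pose X := 2 * gamma - c; pose XY := X + 6 * (delta * k).
have X1 : 0 <= 7 * om - X by rewrite /X; clear -om0 E1 E2 F1 F2; lra.
have X2 : 0 <= X + 7 * om by rewrite /X; clear -om0 E1 E2 F1 F2; lra.
have XY1 : 0 <= 7 * om - XY by rewrite /XY /X; clear -om0 E1 E2 F1 F2; lra.
have XY2 : 0 <= XY + 7 * om by rewrite /XY /X; clear -om0 E1 E2 F1 F2; lra.
have th1' : 0 <= 1 - th by rewrite subr_ge0.
have : `|2 * gamma + 6 * delta * (k * th) - wt| <= 8 * om.
  have -> : 2 * gamma + 6 * delta * (k * th) - wt =
      (1 - th) * X + th * XY - (wt - c) by rewrite /XY /X; ring.
  move/andP: hw => [hw1 hw2].
  have := mulr_ge0 th1' X1; have := mulr_ge0 th1' X2.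
  have := mulr_ge0 (ltW th0) XY1; have := mulr_ge0 (ltW th0) XY2.
  move=> h1 h2 h3 h4; clear -h1 h2 h3 h4 hw1 hw2.
  by rewrite ler_norml; apply/andP; split; lra.
move=> h; have -> : 64 * om ^+ 2 = (8 * om) ^+ 2 by ring.
by rewrite -real_normK ?num_real// ler_sqr ?nnegrE// mulr_ge0.
Qed.

(** On a cell w'' differs from c = w''(p) by at most om = (K (q - p))^(1/2).
    Integrating once and twice bounds the slope and the value of w at q relative to
    the parabola with second derivative c, and the Hermite cubic shares these
    data. *)
Lemma hermite_error (w z : H2 a b) K p q gamma delta t : 0 <= K ->
  (forall x y, x \in `[a, b] -> y \in `[a, b] ->
     (H2_d2 w y - H2_d2 w x) ^+ 2 <= K * `|y - x|) ->
  a <= p -> p < q -> q <= b -> cubic_on z p q gamma delta ->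
  H2_fun z p = H2_fun w p -> H2_d1 z p = H2_d1 w p ->
  H2_fun z q = H2_fun w q -> H2_d1 z q = H2_d1 w q ->
  p < t -> t <= q -> (H2_d2 z t - H2_d2 w t) ^+ 2 <= 64 * K * (q - p).
Proof.
move=> K0 wK ap pq qb [z0 z1 z2] zp zp' zq zq' pt tq.
set k := q - p; have k0 : 0 < k by rewrite subr_gt0.
pose om := Num.sqrt (K * k); have om0 : 0 <= om by exact: sqrtr_ge0.
have om2 : om ^+ 2 = K * k by rewrite sqr_sqrtr// mulr_ge0// ltW.
set c := H2_d2 w p.
have inab x : p <= x -> x <= q -> x \in `[a, b].
  by move=> px xq; rewrite in_itv/= (le_trans ap px) (le_trans xq qb).
have wc x : p <= x -> x <= q -> c - om <= H2_d2 w x <= c + om.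
  move=> px xq; have := wK p x (inab _ (lexx p) (ltW pq)) (inab x px xq).
  rewrite ger0_norm ?subr_ge0// -/c => h.
  have : (H2_d2 w x - c) ^+ 2 <= om ^+ 2.
    by rewrite om2 (le_trans h)// ler_wpM2l// lerD2r.
  rewrite -[X in X <= _]real_normK ?num_real// ler_sqr ?nnegrE// ler_norml.
  by move=> /andP[? ?]; apply/andP; split; lra.
have [L0 L1 L2] := H2_L2 w; have [w0 w1] := H2_weak_derivative w.
have [c0 c1] := H2_continuous w.
have mab : measurable (`[a, b] : set (measurableTypeR R)) by exact: measurable_itv.
have sub x : x <= q -> `[p, x] `<=` (`[a, b] : set R).
  by move=> xq; apply: subset_itv; rewrite bnd_simp// (le_trans xq).
have itg f x : mu.-integrable `[a, b] (EFin \o f) -> x <= q ->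
    mu.-integrable `[p, x] (EFin \o f).
  move=> fi xq; have mpx : measurable (`[p, x] : set (measurableTypeR R)).
    exact: measurable_itv.
  exact: (integrableS mab mpx (sub x xq) fi).
have d1 x : p <= x -> x <= q ->
    (H2_d1 w p) + (c - om) * (x - p) <= H2_d1 w x <= H2_d1 w p + (c + om) * (x - p).
  move=> px xq.
  have wb s : p <= s -> s <= x ->
      (c - om) + 0 * (s - p) <= H2_d2 w s <= (c + om) + 0 * (s - p).
    by move=> ps sx; rewrite !mul0r !addr0 wc// (le_trans sx).
  have := Rintegral_affine_bounds px (itg _ _ (L2_integrable L2) xq) wb.
  rewrite (weak_FTC_continuous ab c1 (L2_integrable L2) w1)// ?(le_trans xq)//.
  by rewrite !mul0r !addr0 => /andP[? ?]; apply/andP; split; lra.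
have d0 : H2_d1 w p * k + (c - om) * k ^+ 2 / 2 <= H2_fun w q - H2_fun w p <=
    H2_d1 w p * k + (c + om) * k ^+ 2 / 2.
  rewrite -(weak_FTC_continuous ab c0 (L2_integrable L1) w0)// ?(ltW pq)//.
  exact: (Rintegral_affine_bounds (ltW pq) (itg _ _ (L2_integrable L1) (lexx q)) d1).
have := d1 q (ltW pq) (lexx q); rewrite -zq' -zp' (z1 q (ltW pq) (lexx q)) -/k.
move: d0; rewrite -zq -zp -zp' (z0 q (ltW pq) (lexx q)) -/k.
rewrite z2//; move: (wc t (ltW pt) tq).
have th0 : 0 < (t - p) / k by rewrite divr_gt0// subr_gt0.
have th1 : (t - p) / k <= 1 by rewrite ler_pdivrMr// mul1r lerD2r.
have tE : t - p = k * ((t - p) / k) by rewrite mulrC divfK// gt_eqF.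
rewrite tE; move: (_ / k) th0 th1 => th th0 th1.
move: (H2_d2 w t) (H2_d1 z p) (H2_fun z p) => wt zp1 zp0 hw hE hF.
rewrite -[leRHS]mulrA -om2.
exact: hermite_cubic_bound th0 th1 hw hE hF.
Qed.

(** The pointwise error estimate holds on ]a, b]; the left end point is dropped
    from the domain of integration because the estimate excludes left ends of
    cells. *)
Lemma energy_diff_le (w z : H2 a b) (s : seq R) K h : itv_partition a b s ->
  mesh a s <= h -> 0 <= K ->
  (forall x y, x \in `[a, b] -> y \in `[a, b] ->
     (H2_d2 w y - H2_d2 w x) ^+ 2 <= K * `|y - x|) ->
  (forall x, x \in a :: s -> H2_fun z x = H2_fun w x /\ H2_d1 z x = H2_d1 w x) ->
  (forall i, (i < size s)%N -> exists gamma delta,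
      cubic_on z (a :: s)`_i s`_i gamma delta) ->
  energy (fun t => H2_d2 z t - H2_d2 w t) <= 64 * K * h * (b - a).
Proof.
move=> abs sh K0 wK zw zc.
have [_ _ Lz] := H2_L2 z; have [_ _ Lw] := H2_L2 w.
have mab : measurable (`[a, b] : set (measurableTypeR R)) by exact: measurable_itv.
have moab : measurable (`]a, b] : set (measurableTypeR R)) by exact: measurable_itv.
have Ld : L2 a b (fun t => H2_d2 z t - H2_d2 w t).
  have := L2_lin (-1) Lw Lz; rewrite (_ : _ + _ = (fun t => H2_d2 z t - H2_d2 w t))//.
  by apply/funext => t; rewrite -[LHS]/(-1 * H2_d2 w t + H2_d2 z t); ring.
have sub : `]a, b] `<=` (`[a, b] : set R) by apply: subset_itv; rewrite bnd_simp.
have di := integrableS mab moab sub (L2_sqr_integrable Ld).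
rewrite -Rintegral_itv_obnd_cbnd//.
have abE : fine (mu `]a, b]) = b - a by rewrite lebesgue_measure_itv/= lte_fin ab.
rewrite -abE -Rintegral_cst//; apply: le_Rintegral => //.
  apply: (integrableS mab moab sub); apply: integrable_continuous.
  exact: continuous_subspaceT (@cst_continuous _ _ _).
move=> t tab; have tab' : t \in `[a, b] by exact: sub.
have [i [p [q [[is_ pE qE] [[pq pt tq plt qpm] _]]]]] := itv_partition_cell ab abs tab'.
have ps : p \in a :: s by rewrite pE mem_nth//= ltnW.
have qs : q \in a :: s by rewrite qE inE mem_nth// orbT.
have [g [d zpq]] := zc i is_; rewrite -pE -qE in zpq.
have [zp zp'] := zw p ps; have [zq zq'] := zw q qs.
have := itv_partition_mem ab abs ps; have := itv_partition_mem ab abs qs.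
rewrite !in_itv/= => /andP[_ qb] /andP[ap _].
have at_ : a < t by move: tab; rewrite /= in_itv/= => /andP[].
apply: (le_trans (hermite_error K0 wK ap pq qb zpq zp zp' zq zq' (plt at_) tq)).
by rewrite ler_wpM2l ?mulr_ge0// (le_trans qpm).
Qed.

(** Expansion of the square of w'' + d, with the mixed term controlled by
    Cauchy-Schwarz. *)
Lemma cvg_energy (w : H2 a b) (z : nat -> H2 a b) (e : nat -> R) :
  e n @[n --> \oo] --> 0 ->
  (forall n, energy (fun t => H2_d2 (z n) t - H2_d2 w t) <= e n) ->
  energy (H2_d2 (z n)) @[n --> \oo] --> energy (H2_d2 w).
Proof.
move=> e0 ze; have [_ _ Lw] := H2_L2 w.
have mab : measurable (`[a, b] : set (measurableTypeR R)) by exact: measurable_itv.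
pose d n t := H2_d2 (z n) t - H2_d2 w t.
have Ld n : L2 a b (d n).
  have [_ _ Lz] := H2_L2 (z n).
  have := L2_lin (-1) Lw Lz; rewrite (_ : _ + _ = d n)//.
  by apply/funext => t; rewrite /d -[LHS]/(-1 * H2_d2 w t + H2_d2 (z n) t); ring.
have zE n : energy (H2_d2 (z n)) = energy (H2_d2 w) +
    2 * \int[mu]_(t in `[a, b]) (H2_d2 w t * d n t) + energy (d n).
  have i1 := L2_sqr_integrable Lw; have i3 := L2_sqr_integrable (Ld n).
  have i2 := integrableZl mab 2 (L2_integrableM Lw (Ld n)).
  rewrite -RintegralZl//; last exact: L2_integrableM.
  rewrite -(RintegralD mab i1 i2) -(RintegralD mab (integrableD mab i1 i2) i3).
  by apply: eq_Rintegral => t _; rewrite /d; ring.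
under eq_fun do rewrite zE.
suff : energy (H2_d2 w) + 2 * \int[mu]_(t in `[a, b]) (H2_d2 w t * d n t) + energy (d n)
    @[n --> \oo] --> energy (H2_d2 w) + 2 * 0 + 0 by rewrite mulr0 !addr0.
apply: cvgD; first apply: cvgD; first exact: cvg_cst.
- apply: cvgM; first exact: cvg_cst.
  apply: (@sqr_cvg0 _ (fun n => energy (H2_d2 w) * e n)).
    by rewrite -(mulr0 (energy (H2_d2 w))); apply: cvgM => //; exact: cvg_cst.
  move=> n; apply: (le_trans (L2_cauchy_schwarz Lw (Ld n))).
  by rewrite ler_wpM2l ?energy_ge0//; exact: ze.
- apply: (squeeze_cvgr _ (cvg_cst 0) e0); apply: nearW => n.
  by rewrite energy_ge0 ze.
Qed.

End HermiteError.

(** * Recovery sequences *)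

Section Recovery.
Context {R : realType} (a b : R) (ab : a < b).
Local Notation mu := (@lebesgue_measure R).
Local Notation energy g := (\int[mu]_(t in `[a, b]) (g t ^+ 2)).

Lemma Vh_spline (w : H2 a b) s : C1_H2 w ->
  (forall i, (i < size s)%N -> exists gamma delta,
      cubic_on w (a :: s)`_i s`_i gamma delta) -> Vh s w.
Proof.
move=> Cw wc; split=> [x _|i is_]; first exact: Cw.
have [g [d [w0 _ _]]] := wc i is_; set p := (a :: s)`_i in w0 *.
exists (Poly [:: H2_fun w p; H2_d1 w p; g; d] \Po ('X - p%:P)).
  by rewrite size_comp_poly2 ?size_XsubC// (leq_trans (size_Poly _)).
move=> x; rewrite in_itv/= => /andP[px xq]; rewrite (w0 x px xq).
rewrite horner_comp hornerXsubC !horner_cons hornerC; ring.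
Qed.

(** The constraint holds almost everywhere and u' is continuous. *)
Lemma vd1_unit (u : H2v a b) : {ae mu, forall x, x \in `[a, b] -> enorm (vd1 u x) = 1} ->
  forall x, x \in `[a, b] -> enorm (vd1 u x) = 1.
Proof.
move=> u1 x xab; pose f t := \sum_i H2_d1 (u i) t ^+ 2.
have fE t : enorm (vd1 u t) ^+ 2 = f t.
  by rewrite enorm2E; apply: eq_bigr => i _; rewrite mxE.
have cf : {within `[a, b], continuous f}.
  apply/subspace_continuousP => z zab; apply: cvg_sum_ord => i.
  have [_ /subspace_continuousP c1] := H2_continuous (u i).
  by rewrite expr2; under eq_fun do rewrite expr2; apply: cvgM; exact: c1.
have f1 : f x = 1.
  apply: (ae_continuous_cst ab cf _ xab).
  have FF := ae_filter_ringOfSetsType mu.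
  apply: (@filterS _ (almost_everywhere mu) FF _ _ _ u1) => t ut tab.
  by rewrite -fE ut// expr1n.
by rewrite -[LHS]ger0_norm ?sqrtr_ge0// -sqrtr_sqr fE f1 sqrtr1.
Qed.

Context (m : nat) (G : 'I_m -> 'M[R]_3) (l : nat) (Lbc : {linear H2v a b -> 'cV[R]_l})
  (lbc : 'cV[R]_l).
Hypothesis Lbc_endpoint : endpoint_op Lbc.

(** The interpolant has the same nodal values and slopes as u, so it inherits the
    unit length of the derivative at the nodes and the boundary conditions, and the
    potential vanishes at all nodes, which makes its interpolant vanish. *)
Lemma hermite_interpolant (u w : H2v a b) (K : 'I_3 -> R) (s : seq R) :
  admissibleD G Lbc lbc u ->
  (forall i, [/\ H2_fun (w i) = H2_fun (u i), H2_d1 (w i) = H2_d1 (u i), 0 <= K i &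
    forall x y, x \in `[a, b] -> y \in `[a, b] ->
      (H2_d2 (w i) y - H2_d2 (w i) x) ^+ 2 <= K i * `|y - x|]) ->
  itv_partition a b s ->
  exists z : H2v a b, [/\ admissible_h Lbc lbc s z,
    \int[mu]_(x in `[a, b]) interp1 (fun t => VD G (vfun z t)) a s x = 0 &
    forall i, energy (fun t => H2_d2 (z i) t - H2_d2 (w i) t) <=
      64 * K i * mesh a s * (b - a)].
Proof.
move=> [[u1 uL] uD] wP abs.
have /choice[z zP] i := hermite_spline ab (H2_fun (u i)) (H2_d1 (u i)) abs.
pose v : H2v a b := [ffun i => z i].
have nodes x : x \in a :: s -> vfun v x = vfun u x /\ vd1 v x = vd1 u x.
  by move=> xs; split; apply/colP => i; rewrite !mxE ffunE;
    have [_ /(_ x xs)[E0 E1] _] := zP i.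
have as_ : a \in a :: s by rewrite mem_head.
have bs : b \in a :: s by have [_ /eqP <-] := abs; exact: mem_last.
exists v; split.
- split.
  + by move=> i; rewrite ffunE; have [Cz _ zc] := zP i; exact: Vh_spline.
  + move=> x xs; have [_ ->] := nodes x xs.
    by rewrite (vd1_unit u1 (itv_partition_mem ab abs xs)) expr1n.
  + have [a0 a1] := nodes a as_; have [b0 b1] := nodes b bs.
    by rewrite (Lbc_endpoint a0 a1 b0 b1).
- have V0 x : x \in a :: s -> VD G (vfun v x) = 0.
    move=> xs; have [-> _] := nodes x xs; apply: VD_confinement.
    exact: uD (itv_partition_mem ab abs xs).
  transitivity (\int[mu]_(x in `[a, b]) (0 * 0 : R)); last first.
    by rewrite mul0r Rintegral_cst ?mul0r.
  apply: eq_Rintegral => t /[!inE] tab; rewrite mul0r; apply/le_anti/andP.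
  have := @interp1_between _ a b s ab abs (fun t => VD G (vfun v t)) t 0 0 tab.
  move=> /(_ _)/andP[] // x xs _; by rewrite V0// lexx.
- move=> i; rewrite ffunE; have [_ zn zc] := zP i; have [w0 w1 K0 wK] := wP i.
  apply: (energy_diff_le ab abs (lexx _) K0 wK _ zc) => x xs.
  by rewrite w0 w1; exact: zn.
Qed.

(** The function chosen for h depends on the partition only; its penalty term is 0
    for every eps, and its bending energy converges to that of u. *)
Lemma recovery_sequence (P : R -> seq R)
    (HP : forall h, 0 < h -> h <= b - a ->
            itv_partition a b (P h) /\ mesh a (P h) = h)
    (kappa : R) (u : H2v a b) : admissibleD G Lbc lbc u -> in_H3v u ->
  exists u_ : R -> H2v a b,
    forall (h eps : nat -> R),
      (forall n, 0 < h n) -> (forall n, 0 < eps n) ->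
      h @ \oo --> 0 -> eps @ \oo --> 0 ->
      Eh G Lbc lbc kappa (P (h n)) (eps n) (u_ (h n)) @[n --> \oo]
        --> Ebend G Lbc lbc kappa u.
Proof.
move=> uA u3.
have wK0 : forall i, exists w : H2 a b, exists K, [/\ H2_fun w = H2_fun (u i),
    H2_d1 w = H2_d1 (u i), energy (H2_d2 w) = energy (H2_d2 (u i)), 0 <= K &
    forall x y, x \in `[a, b] -> y \in `[a, b] ->
      (H2_d2 w y - H2_d2 w x) ^+ 2 <= K * `|y - x|].
  by move=> i; exact: H3_regular.
have [w wK1] := choice wK0; have [K wK] := choice wK1.
pose W : H2v a b := [ffun i => w i].
have WP i : [/\ H2_fun (W i) = H2_fun (u i), H2_d1 (W i) = H2_d1 (u i), 0 <= K i &
    forall x y, x \in `[a, b] -> y \in `[a, b] ->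
      (H2_d2 (W i) y - H2_d2 (W i) x) ^+ 2 <= K i * `|y - x|].
  by rewrite ffunE; have [] := wK i.
have /choice[u_ uP] h : exists z : H2v a b, 0 < h -> h <= b - a ->
    [/\ admissible_h Lbc lbc (P h) z,
      \int[mu]_(x in `[a, b]) interp1 (fun t => VD G (vfun z t)) a (P h) x = 0 &
      forall i, energy (fun t => H2_d2 (z i) t - H2_d2 (W i) t) <=
        64 * K i * h * (b - a)].
  (* u itself serves as a default for the values of h without a partition. *)
  have [h0|h0] := ltP 0 h; last by exists u.
  have [hb|hb] := leP h (b - a); last by exists u.
  have [abs mE] := HP h h0 hb.
  have [z zP] := hermite_interpolant uA WP abs.
  by exists z; rewrite mE in zP.
exists u_ => h eps h0 eps0 ch ceps.
(* From the index N on the mesh sizes are at most b - a. *)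
have [N _ hN] : \forall n \near \oo, h n <= b - a.
  by apply: (cvgr_le 0 ch); rewrite subr_gt0.
have diff0 i : 64 * K i * h (n + N)%N * (b - a) @[n --> \oo] --> 0.
  have -> : 0 = 64 * K i * 0 * (b - a) by rewrite mulr0 mul0r.
  apply: cvgM; last exact: cvg_cst.
  by apply: cvgM; [exact: cvg_cst|rewrite (cvg_shiftn N h)].
have cE i : energy (H2_d2 (u_ (h (n + N)%N) i)) @[n --> \oo] --> energy (H2_d2 (u i)).
  have -> : energy (H2_d2 (u i)) = energy (H2_d2 (W i)).
    by rewrite ffunE; have [_ _ ->] := wK i.
  apply: (cvg_energy (diff0 i)) => n.
  by have [] := uP (h (n + N)%N) (h0 _) (hN _ (leq_addl _ _)).
rewrite -(cvg_shiftn N) /=.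
have -> : Ebend G Lbc lbc kappa u =
    (kappa / 2 * \sum_i energy (H2_d2 (u i)))%:E by rewrite /Ebend asboolT// bendE.
have EhE n : Eh G Lbc lbc kappa (P (h (n + N)%N)) (eps (n + N)%N) (u_ (h (n + N)%N)) =
    (kappa / 2 * \sum_i energy (H2_d2 (u_ (h (n + N)%N) i)))%:E.
  have [zA z0 _] := uP (h (n + N)%N) (h0 _) (hN _ (leq_addl _ _)).
  by rewrite /Eh asboolT// bendE z0 mulr0 addr0.
under eq_fun do rewrite EhE.
apply/fine_cvgP; split; first exact: nearW.
by apply: cvgM; [exact: cvg_cst|exact: cvg_sum_ord].
Qed.
End Recovery.

(** * Gamma convergence *)

Theorem proposition2p1 (R : realType) (a b : R) (hab : a < b)
    (m : nat) (hm : (0 < m)%N) (G : 'I_m -> 'M[R]_3)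
    (Gsym : forall r, (G r)^T = G r) (Gpsd : forall r, psd (G r))
    (l : nat) (Lbc : {linear H2v a b -> 'cV[R]_l}) (lbc : 'cV[R]_l)
    (Lbc_bounded : bounded_op Lbc) (Lbc_endpoint : endpoint_op Lbc)
    (P : R -> seq R)
    (HP : forall h, 0 < h -> h <= b - a ->
            itv_partition a b (P h) /\ mesh a (P h) = h)
    (kappa : R) (hkappa : 0 < kappa) :
  (forall (h eps : nat -> R),
     (forall n, 0 < h n) -> (forall n, 0 < eps n) ->
     h @ \oo --> 0 -> eps @ \oo --> 0 ->
     forall (u_ : nat -> H2v a b) (u : H2v a b), weak_cvg u_ u ->
       (Ebend G Lbc lbc kappa u <=
        limn_einf (fun n => Eh G Lbc lbc kappa (P (h n)) (eps n) (u_ n)))%E) /\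
  (forall u : H2v a b, admissibleD G Lbc lbc u -> in_H3v u ->
     exists u_ : R -> H2v a b,
       forall (h eps : nat -> R),
         (forall n, 0 < h n) -> (forall n, 0 < eps n) ->
         h @ \oo --> 0 -> eps @ \oo --> 0 ->
         Eh G Lbc lbc kappa (P (h n)) (eps n) (u_ (h n)) @[n --> \oo]
           --> Ebend G Lbc lbc kappa u).
Proof.
split.
  move=> h eps h0 eps0 ch ceps u_ u uu.
  exact: (liminf_inequality hab G lbc Lbc_bounded HP hkappa h0 eps0 ch ceps uu).
by move=> u uA u3; exact: (recovery_sequence hab Lbc_endpoint HP kappa uA u3).
Qed.
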